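(* Let $\mathbb{F}$ be a field (of arbitrary characteristic), let $\Delta$ be an $\mathbb{F}$-homology $(d-1)$-sphere, and suppose that $\Delta'$ is obtained from $\Delta$ via a bistellar $0$-move. Then $\Delta$ is generically anisotropic over $\mathbb{F}$ if and only if $\Delta'$ is generically anisotropic over $\mathbb{F}$.
   Context: Homology spheres: for a field $\mathbb{F}$, a finite simplicial complex $\Delta$ is an $\mathbb{F}$-homology $d$-sphere if for every face $\sigma\in\Delta$ (including $\sigma=\emptyset$) the link $\mathrm{lk}_\sigma\Delta=\{\tau\in\Delta:\tau\cup\sigma\in\Delta,\ \tau\cap\sigma=\emptyset\}$ has the same homology with coefficients in $\mathbb{F}$ as the sphere $S^{d-|\sigma|}$, where $|\sigma|$ is the number of vertices of $\sigma$ (with $S^{-1}=\emptyset$, and the complex $\{\emptyset\}$ regarded as a $(-1)$-sphere). Bistellar $0$-move: let $\Delta$ be a pure simplicial complex, $\sigma$ a facet (maximal face) of $\Delta$, and $\tau=\{v\}$ where $v$ is a new vertex not in $\Delta$. The bistellar $0$-move at $\sigma$ replaces $\Delta$ by $\chi_\sigma\Delta=(\Delta\setminus\{\sigma\})\cup(\partial\sigma*\{v\})$, where $\partial\sigma$ is the complex of all proper subsets of $\sigma$ and $\partial\sigma*\{v\}=\{\rho,\ \rho\cup\{v\}:\rho\in\partial\sigma\}$ is the cone over it with apex $v$. Face rings: for a field $K$ and a simplicial complex $\Delta$ with vertex set $[m]=\{1,\dots,m\}$, the face ring is $K[\Delta]=K[x_1,\dots,x_m]/I_\Delta$, graded by $\deg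 x_i=1$, where $I_\Delta$ is generated by the monomials $x_{i_1}\cdots x_{i_k}$ with $\{i_1,\dots,i_k\}\notin\Delta$. If $\dim\Delta=d-1$, a linear system of parameters (l.s.o.p.) for $K[\Delta]$ is a sequence $\Theta=(\theta_1,\dots,\theta_d)$ of $d$ linear forms such that the Artinian reduction $K(\Delta;\Theta):=K[\Delta]/(\Theta)$ is a finite-dimensional $K$-vector space; $K(\Delta;\Theta)_i$ denotes its degree $i$ component. Anisotropy: for a homology $(d-1)$-sphere $\Delta$, an Artinian reduction $K(\Delta;\Theta)$ is anisotropic if for every $i\le d/2$ and every nonzero $u\in K(\Delta;\Theta)_i$, the square $u^2$ is nonzero in $K(\Delta;\Theta)_{2i}$. An $\mathbb{F}$-homology $(d-1)$-sphere $\Delta$ with vertex set $[m]$ is generically anisotropic over $\mathbb{F}$ if $\mathbf{k}(\Delta;\Theta)$ is anisotropic, where $\mathbf{k}=\mathbb{F}(a_{ij}:1\le i\le d,\ 1\le j\le m)$ is the field of rational functions in independent variables $a_{ij}$ and $\Theta=(\theta_1,\dots,\theta_d)$ with $\theta_i=\sum_{j=1}^m a_{ij}x_j$ (this $\Theta$ is an l.s.o.p. for $\mathbf{k}[\Delta]$). *)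

(* Defs.v *)
From HB Require Import structures.
From mathcomp Require Import all_boot all_order all_algebra.
From mathcomp Require Import boolp.
From mathcomp Require Import mpoly.

Set Implicit Arguments.
Unset Strict Implicit.
Unset Printing Implicit Defensive.

Import GRing.Theory.
Local Open Scope ring_scope.
Local Open Scope quotient_scope.

(* Complexes are families of subsets of an ambient finite type V. Elements of *)
(* V need not be vertices, which leaves room for new ones.                    *)
Section Complexes.
Variable V : finType.
Implicit Types (D : {set {set V}}) (s t : {set V}) (v : V).

Definition simplicial_complex D : Prop :=
  set0 \in D /\ (forall s t, s \in D -> t \subset s -> t \in D).

Definition vertices D : {set V} := [set v | [set v] \in D].

Definition facet D s : bool := maxset (fun t => t \in D) s.

Definition link D s : {set {set V}} :=
  [set t in D | (t :|: s \in D) && (t :&: s == set0)].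

Definition bdry_complex s : {set {set V}} := [set t : {set V} | t \proper s].

Definition cone D v : {set {set V}} := D :|: [set v |: t | t in D].

Definition bistellar0 D s v : {set {set V}} :=
  (D :\ s) :|: cone (bdry_complex s) v.

Definition bistellar0_move D D' : Prop :=
  exists s v, [/\ facet D s, v \notin vertices D & D' = bistellar0 D s v].

End Complexes.

(* Reduced simplicial homology over F. Chains are spanned by all subsets of V,*)
(* oriented by the enumeration order of V; homological degrees are shifted by *)
(* one, a simplex with k vertices having dimension k - 1. The empty face      *)
(* (k = 0) is a simplex, so that the homology is reduced.                     *)
Section Homology.
Variables (F : fieldType) (V : finType).
Implicit Types (D : {set {set V}}) (s t : {set V}) (v : V).

Definition chain : vectType F := {ffun {set V} -> F^o}.

Definition simplex t : chain := [ffun u => (u == t)%:R].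

Definition position t v : nat :=
  #|[set u in t | (enum_rank u < enum_rank v)%N]|.

Definition simplex_bdry t : chain :=
  \sum_(v in t) (-1) ^+ position t v *: simplex (t :\ v).

Definition bdry_fun (c : chain) : chain :=
  \sum_(t : {set V}) (c : {ffun {set V} -> F^o}) t *: simplex_bdry t.

Fact bdry_fun_is_linear : linear bdry_fun.
Proof.
move=> a c c'; rewrite /bdry_fun scaler_sumr -big_split /=.
by apply: eq_bigr => t _; rewrite !ffunE scalerDl scalerA.
Qed.
HB.instance Definition _ :=
  GRing.isLinear.Build F chain chain *:%R bdry_fun bdry_fun_is_linear.

Definition bdry : 'End(chain) := linfun bdry_fun.

Lemma bdry_simplex t : bdry (simplex t) = simplex_bdry t.
Proof.
rewrite lfunE /= /bdry_fun (bigD1 t) //= ffunE eqxx scale1r big1 ?addr0 //.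
by move=> u ut; rewrite ffunE (negPf ut) scale0r.
Qed.

Lemma position_lt t v w : (enum_rank w < enum_rank v)%N ->
  position (t :\ v) w = position t w.
Proof.
move=> wv; apply: eq_card => u; rewrite !inE; case: eqP => //= ->.
by rewrite ltnNge ltnW // andbF.
Qed.
Lemma position_gt t v w : v \in t -> (enum_rank v < enum_rank w)%N ->
  position t w = (position (t :\ v) w).+1.
Proof.
move=> vt vw; rewrite /position (cardsD1 v) !inE vt vw add1n; congr _.+1.
by apply: eq_card => u; rewrite !inE andbA.
Qed.

Lemma bdry_bdry (c : chain) : bdry (bdry c) = 0.
Proof.
have simpl0 t : bdry (simplex_bdry t) = 0.
  rewrite linear_sum /=; pose sg (v w : V) : F := (-1) ^+ position t v * (-1) ^+ position (t :\ v) w.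
  rewrite (eq_bigr (fun v => \sum_(w in t :\ v) sg v w *: simplex (t :\ v :\ w))); last first.
    move=> v vt; rewrite linearZ /= bdry_simplex scaler_sumr.
    by apply: eq_bigr => w _; rewrite scalerA.
  pose lt (v w : V) := (enum_rank v < enum_rank w)%N.
  rewrite (eq_bigr (fun v => \sum_(w in t | lt w v) sg v w *: simplex (t :\ v :\ w)
    + \sum_(w in t | lt v w) sg v w *: simplex (t :\ v :\ w))); last first.
    move=> v vt; rewrite (bigID (lt ^~ v)) /=; congr (_ + _); apply: eq_bigl => w; rewrite !inE /lt.
      by case: eqP => [->|]; rewrite ?ltnn ?andbF.
    rewrite -leqNgt leq_eqVlt; case: eqVneq => [->|wv] /=; first by rewrite ltnn andbF.
    by rewrite (inj_eq val_inj) (inj_eq enum_rank_inj) eq_sym (negPf wv).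
  rewrite big_split /=; set X := \sum_(i in t) _; set Y := \sum_(i in t) _.
  suff -> : Y = - X by rewrite subrr.
  rewrite /X /Y (exchange_big_dep (mem t)) /=; last by move=> ? ? _ /andP[].
  rewrite -sumrN; apply: eq_bigr => v vt; rewrite -sumrN.
  rewrite (eq_bigl (fun w => (w \in t) && lt w v)); last by move=> w; rewrite vt.
  apply: eq_bigr => w /andP[wt wv].
  have -> : t :\ w :\ v = t :\ v :\ w by apply/setP => u; rewrite !inE andbCA.
  rewrite -scaleNr; congr (_ *: _); rewrite /sg.
  rewrite /lt in wv; by rewrite (position_lt t wv) (position_gt wt wv) exprS mulN1r mulNr opprK mulrC.
rewrite [bdry c]lfunE /= /bdry_fun linear_sum big1 // => t _.
by rewrite linearZ /= simpl0 scaler0.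
Qed.

Definition chains D (k : nat) : {vspace chain} :=
  <<[seq simplex t | t <- enum [set t in D | #|t| == k]]>>%VS.

Definition cycles D k : {vspace chain} := (chains D k :&: lker bdry)%VS.

Definition boundaries D k : {vspace chain} := (bdry @: chains D k.+1)%VS.

(* The dimension in degree k - 1; boundaries are cycles by bdry_bdry when D is *)
(* a simplicial complex.                                                      *)
Definition homology_dim D k : nat := (\dim (cycles D k) - \dim (boundaries D k))%N.

(* The complex {set0} has the homology of a (-1)-sphere. For n < -1 all the   *)
(* reduced homology has to vanish, which fails for {set0}; hence all facets   *)
(* of a homology n-sphere have exactly n + 1 vertices.                        *)
Definition same_homology_as_sphere (n : int) D : Prop :=
  forall k : nat, homology_dim D k = (k%:Z - 1 == n) :> nat.

Definition homology_sphere (n : int) D : Prop :=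
  simplicial_complex D /\
  (forall s, s \in D -> same_homology_as_sphere (n - #|s|%:Z) (link D s)).

End Homology.

(* The quotient of R by the ideal generated by S. The quotients by ideals of  *)
(* ring_quotient are restricted to proper ideals, hence this construction,    *)
(* which allows the zero ring.                                                *)
Section QuotientRing.
Variables (R : comPzRingType) (S : R -> Prop).

Definition generated_ideal (x : R) : Prop :=
  exists2 c : seq (R * R),
    (forall p, p \in c -> S p.2) & x = \sum_(p <- c) p.1 * p.2.

Definition in_ideal : pred R := fun x => `[< generated_ideal x >].

Fact in_ideal_zmod_closed : zmod_closed in_ideal.
Proof.
split=> [|x y /asboolP[c Sc ->] /asboolP[c' Sc' ->]]; apply/asboolP.
  by exists [::]; rewrite ?big_nil.
exists (c ++ [seq (- p.1, p.2) | p <- c']).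
  move=> p; rewrite mem_cat => /orP[/Sc //|/mapP[q /Sc' Sq ->] //].
rewrite big_cat big_map /= -sumrN; congr (_ + _).
by apply: eq_bigr => p _; rewrite mulNr.
Qed.
HB.instance Definition _ :=
  GRing.isZmodClosed.Build R in_ideal in_ideal_zmod_closed.

Lemma in_idealMr a x : x \in in_ideal -> a * x \in in_ideal.
Proof.
move=> /asboolP[c Sc ->]; apply/asboolP; exists [seq (a * p.1, p.2) | p <- c].
  by move=> p /mapP[q /Sc Sq ->].
by rewrite big_map mulr_sumr; apply: eq_bigr => p _; rewrite mulrA.
Qed.

Lemma in_ideal_gen x : S x -> x \in in_ideal.
Proof.
move=> Sx; apply/asboolP; exists [:: (1, x)]; last by rewrite big_seq1 mul1r.
by move=> p; rewrite inE => /eqP ->.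
Qed.

Definition ideal : zmodClosed R := GRing.ZmodClosed.clone R in_ideal _.

Definition quot_ring : Type := {ideal_quot ideal}.
HB.instance Definition _ := GRing.Zmodule.on quot_ring.

Definition quot_proj (x : R) : quot_ring := \pi_({ideal_quot ideal}) x.

Lemma quot_projP x y : reflect (quot_proj x = quot_proj y) (x - y \in in_ideal).
Proof. by rewrite Quotient.idealrBE; apply: eqP. Qed.

Lemma quot_proj_surj (u : quot_ring) : exists x, u = quot_proj x.
Proof. by exists (repr u); rewrite /quot_proj reprK. Qed.

Definition quot_one : quot_ring := quot_proj 1.
Definition quot_mul (u v : quot_ring) : quot_ring := quot_proj (repr u * repr v).

Lemma quot_projM x y : quot_proj (x * y) = quot_mul (quot_proj x) (quot_proj y).
Proof.
have reprP z : z - repr (quot_proj z) \in in_ideal.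
  by apply/quot_projP; rewrite /quot_proj reprK.
apply/quot_projP; set x' := repr _; set y' := repr _.
have -> : x * y - x' * y' = y * (x - x') + x' * (y - y').
  by rewrite !mulrBr addrA [y * x]mulrC [y * x']mulrC subrK.
by rewrite rpredD // in_idealMr ?reprP.
Qed.

Fact quot_mulA : associative quot_mul.
Proof.
move=> u v w; have [x ->] := quot_proj_surj u.
have [y ->] := quot_proj_surj v; have [z ->] := quot_proj_surj w.
by rewrite -!quot_projM mulrA.
Qed.
Fact quot_mulC : commutative quot_mul.
Proof. by move=> u v; rewrite /quot_mul mulrC. Qed.
Fact quot_mul1 : left_id quot_one quot_mul.
Proof.
by move=> u; have [x ->] := quot_proj_surj u; rewrite -quot_projM mul1r.
Qed.
Lemma quot_projD x y : quot_proj (x + y) = quot_proj x + quot_proj y.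
Proof. by rewrite /quot_proj !piE. Qed.
Fact quot_mulDl : left_distributive quot_mul +%R.
Proof.
move=> u v w; have [x ->] := quot_proj_surj u.
have [y ->] := quot_proj_surj v; have [z ->] := quot_proj_surj w.
by rewrite -quot_projD -!quot_projM -quot_projD mulrDl.
Qed.
HB.instance Definition _ := GRing.Zmodule_isComPzRing.Build quot_ring
  quot_mulA quot_mulC quot_mul1 quot_mulDl.

Fact quot_proj_is_zmod_morphism : zmod_morphism quot_proj.
Proof. by move=> x y; rewrite /quot_proj !piE. Qed.
HB.instance Definition _ := GRing.isZmodMorphism.Build R quot_ring quot_proj
  quot_proj_is_zmod_morphism.
Fact quot_proj_is_monoid_morphism : monoid_morphism quot_proj.
Proof. by split=> //; apply: quot_projM. Qed.
HB.instance Definition _ := GRing.isMonoidMorphism.Build R quot_ring quot_proj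
  quot_proj_is_monoid_morphism.

End QuotientRing.

(* The m vertices of D are numbered by 'I_m through the enumeration of        *)
(* vertices D; elements of V that are not vertices carry no variable.         *)
Section FaceRing.
Variables (K : fieldType) (V : finType) (D : {set {set V}}).

Local Notation m := #|vertices D|.

Definition nonface_monomial (p : {mpoly K[m]}) : Prop :=
  exists2 A : {set 'I_m},
    [set enum_val j | j in A] \notin D & p = \prod_(j in A) 'X_j.

Definition face_ring : comPzRingType := quot_ring nonface_monomial.

Definition face_ring_proj (p : {mpoly K[m]}) : face_ring :=
  quot_proj nonface_monomial p.

Section Reduction.
Variables (d : nat) (Theta : 'I_d -> {mpoly K[m]}).

Definition parameter (u : face_ring) : Prop :=
  exists i, u = face_ring_proj (Theta i).

Definition artinian_reduction : comPzRingType := quot_ring parameter.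

Definition degree_component (i : nat) (u : artinian_reduction) : Prop :=
  exists2 p : {mpoly K[m]},
    p \is i.-homog & u = quot_proj parameter (face_ring_proj p).

Definition anisotropic : Prop :=
  forall i : nat, (i.*2 <= d)%N ->
  forall u : artinian_reduction, degree_component i u -> u <> 0 -> u ^+ 2 <> 0.

End Reduction.
End FaceRing.

Section Generic.
Variables (F : fieldType) (d : nat) (V : finType) (D : {set {set V}}).

Local Notation m := #|vertices D|.

Definition generic_field : fieldType := {fraction {mpoly F[d * m]}}.

Definition generic_coef (i : 'I_d) (j : 'I_m) : generic_field :=
  FracField.tofrac ('X_(mxvec_index i j) : {mpoly F[d * m]}).

Definition generic_form (i : 'I_d) : {mpoly generic_field[m]} :=
  \sum_(j < m) generic_coef i j *: 'X_j.

Definition generically_anisotropic : Prop := anisotropic generic_form.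

End Generic.

(* Main.v *)
(** A bistellar 0-move at a facet s subdivides s at a new vertex v. Over a field
    containing generic columns, write the new column as a_v = sum c_j a_j with
    j in s. With J the ideal defining k(Delta; Theta), mapping x_j to
    x_j + c_j x_v embeds A = k(Delta; Theta) into A' = k(Delta'; Theta'), and
    A' = A[t] / (x_j t, t^d - gamma x_s), where t = x_v and gamma is a sign
    divided by the product of the c_j. An element of degree i of A' is thus
    u + r t^i, with square u^2 + r^2 t^2i.

    If A' is anisotropic then so is its subring A. Conversely the c_j are
    algebraically independent over the field k of the coefficients of Delta,
    and A stays anisotropic over k(c): compare leading monomials in c. In the
    middle degree, u^2 + r^2 gamma x_s = 0 is excluded by the parity of the
    leading exponents, the product of the c_j being squarefree, provided that
    x_s is nonzero in A. That last fact is where Delta being a homology sphere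
    is used: a fundamental cycle z has a nonzero coefficient on every facet,
    and Lee's formula
      f |-> sum over facets t of (z_t / [t]) f(w_t) / prod_(j in t) w_tj,
    where [t] is the determinant of the columns of t and w_t the coordinates of
    a generic vector w in the basis a_t, vanishes on J in degree d and takes
    the value z_s / [s] at x_s. *)

(* The obstacle is that k and the generic field k' of Delta' differ. Anisotropy passes down along
   every field extension, since ideal membership is the solvability of a linear system, but the
   passage up is available only along a purely transcendental one. From Delta' to Delta, one works
   over k', which contains k, and descends to k at the end. From Delta to Delta', one climbs from k
   to k(c), subdivides there, and descends to k', embedded in k(c) by writing the column of v
   through the indeterminates c. The relation for t^d comes from x_s = 0 in A'. As (x_j + c_j t) t =
   0 there, expanding x_s as the product of the (x_j + c_j t) - c_j t kills all mixed terms; what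
   remains is the image of the monomial x_s of A, plus t^d times the product of the - c_j. Lee's
   formula needs one generic vector besides the columns of Delta: the column of v over k' supplies
   it. Comparing leading monomials treats all characteristics alike. *)
Require Import Defs.
From HB Require Import structures.
From mathcomp Require Import all_boot all_order all_algebra.
From mathcomp Require Import ring zify boolp mpoly.

Set Implicit Arguments.
Unset Strict Implicit.
Unset Printing Implicit Defensive.

Import Order.TTheory GRing.Theory.
Local Open Scope ring_scope.

(** * Ideals and evaluation of polynomials *)

Section Ideals.
Variables (R : comPzRingType) (S : R -> Prop).

Lemma in_ideal_ind (P : R -> Prop) :
  P 0 -> (forall x y, P x -> P y -> P (x + y)) ->
  (forall g h, S h -> P (g * h)) -> forall x, x \in in_ideal S -> P x.
Proof.
move=> P0 PD PM x /asboolP[c Sc ->]; elim: c Sc => [|q c IH] Sc.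
  by rewrite big_nil.
rewrite big_cons; apply: PD; first by apply/PM/Sc; rewrite inE eqxx.
by apply: IH => p pc; apply: Sc; rewrite inE pc orbT.
Qed.

Lemma in_idealMl a x : x \in in_ideal S -> x * a \in in_ideal S.
Proof. by rewrite mulrC; apply: in_idealMr. Qed.

Lemma in_ideal_eq x y : x \in in_ideal S -> x = y -> y \in in_ideal S.
Proof. by move=> xS <-. Qed.

Lemma quot_proj0 x : (quot_proj S x = 0) <-> x \in in_ideal S.
Proof.
rewrite -(rmorph0 (quot_proj S)) -[in X in _ <-> X](subr0 x).
by split=> /quot_projP.
Qed.

Lemma in_ideal_morph (R' : comPzRingType) (S' : R' -> Prop)
    (f : {rmorphism R -> R'}) :
  (forall h, S h -> f h \in in_ideal S') ->
  forall x, x \in in_ideal S -> f x \in in_ideal S'.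
Proof.
move=> fS; apply: in_ideal_ind => [|x y|g h /fS]; first by rewrite rmorph0 rpred0.
  by rewrite rmorphD; apply: rpredD.
by rewrite rmorphM; apply: in_idealMr.
Qed.

End Ideals.

Lemma in_ideal_ext (R : comPzRingType) (S S' : R -> Prop) :
  (forall h, S h -> h \in in_ideal S') ->
  forall x, x \in in_ideal S -> x \in in_ideal S'.
Proof. exact: (@in_ideal_morph _ _ _ _ idfun). Qed.

(** The Artinian reduction is a quotient of a quotient; this collapses both steps into one ideal of
    polynomials. Elements of the upper ideal lift, and two lifts differ by an element of the lower
    ideal. *)
Lemma in_ideal_quot (R : comPzRingType) (S T : R -> Prop) x :
  quot_proj (fun u => exists2 t, T t & u = quot_proj S t) (quot_proj S x) = 0 <->
  x \in in_ideal (fun h => S h \/ T h).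
Proof.
rewrite quot_proj0; split; last first.
  apply: (@in_ideal_morph _ _ _ _ (quot_proj S)) => h [Sh|Th].
    by rewrite /= (iffRL (quot_proj0 _ _) (in_ideal_gen Sh)) rpred0.
  by apply: in_ideal_gen; exists h.
move=> xI; suff: forall u, u \in in_ideal (fun u => exists2 t, T t & u = quot_proj S t) ->
    exists2 y, u = quot_proj S y & y \in in_ideal (fun h => S h \/ T h).
  move=> /(_ _ xI)[y /quot_projP xy yI]; rewrite -(subrK y x) rpredD //.
  by apply: in_ideal_ext xy => h Sh; apply: in_ideal_gen; left.
apply: in_ideal_ind => [|u w [y -> yI] [z -> zI]|g h [t Tt ->]].
- by exists 0; rewrite ?rmorph0 ?rpred0.
- by exists (y + z); rewrite ?rmorphD ?rpredD.
- have [y ->] := quot_proj_surj g; exists (y * t); rewrite ?rmorphM //.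
  by apply/in_idealMr/in_ideal_gen; right.
Qed.

Section MPolyInduction.
Variables (n : nat) (R : comNzRingType).

Lemma mpoly_ind_var (P : {mpoly R[n]} -> Prop) :
  (forall c, P c%:MP) -> (forall p q, P p -> P q -> P (p + q)) ->
  (forall i p, P p -> P ('X_i * p)) -> forall p, P p.
Proof.
(* [Q] is closed under products and contains the variables, hence all monomials. *)
move=> PC PD PX; pose Q q := forall p, P p -> P (q * p).
have QM q1 q2 : Q q1 -> Q q2 -> Q (q1 * q2).
  by move=> Q1 Q2 p Pp; rewrite -mulrA; apply/Q1/Q2.
have Q1 : Q 1 by move=> p; rewrite mul1r.
have QX m : Q 'X_[m].
  rewrite mpolyXE_id; apply: big_ind => // i _.
  elim: (m i) => [|k IH]; first by rewrite expr0.
  by rewrite exprS; apply: QM => // p; apply: PX.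
apply: mpolyind => [|c m p _ _ Pp]; first by rewrite -(mpolyC0 n R).
by apply: PD => //; rewrite -mul_mpolyC mulrC; apply: QX.
Qed.

End MPolyInduction.

Section VariablesOfSet.
Variables (V : finType) (R : comNzRingType).

Definition var (u : V) : {mpoly R[#|V|]} := 'X_(enum_rank u).

Section Evaluation.
Variables (S : comNzRingType) (f : {rmorphism R -> S}) (h : V -> S).

(* Locked: otherwise unification unfolds compositions of evaluations. *)
Fact vmap_key : unit. Proof. exact: tt. Qed.
Definition vmap : {mpoly R[#|V|]} -> S := locked_with vmap_key (mmap f (h \o enum_val)).

Lemma vmapE : vmap = mmap f (h \o enum_val).
Proof. exact: locked_withE. Qed.

Fact vmap_is_zmod_morphism : zmod_morphism vmap.
Proof. by rewrite vmapE; apply: raddfB. Qed.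
HB.instance Definition _ := GRing.isZmodMorphism.Build _ _ vmap vmap_is_zmod_morphism.
Fact vmap_is_monoid_morphism : monoid_morphism vmap.
Proof. by rewrite vmapE; split=> [|p q]; rewrite ?rmorph1 ?rmorphM. Qed.
HB.instance Definition _ := GRing.isMonoidMorphism.Build _ _ vmap vmap_is_monoid_morphism.

Lemma vmapC c : vmap c%:MP = f c. Proof. by rewrite vmapE mmapC. Qed.
Lemma vmapZ c p : vmap (c *: p) = f c * vmap p. Proof. by rewrite vmapE mmapZ. Qed.
Lemma vmapX u : vmap (var u) = h u.
Proof. by rewrite vmapE mmapX mmap1U /= enum_rankK. Qed.

End Evaluation.

Lemma mpoly_ind_vars (P : {mpoly R[#|V|]} -> Prop) :
  (forall c, P c%:MP) -> (forall p q, P p -> P q -> P (p + q)) ->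
  (forall u p, P p -> P (var u * p)) -> forall p, P p.
Proof.
move=> PC PD PX; apply: mpoly_ind_var => // i p.
by rewrite -[i]enum_valK; apply: PX.
Qed.

Lemma var_homog u : var u \is 1.-homog.
Proof. by rewrite dhomogX; apply/eqP/mdeg1. Qed.

End VariablesOfSet.

(* As in Defs.generic_form, but over all the elements of V: those that are not
   vertices of D are nonfaces, so their variables vanish in the quotient. *)
Section StanleyReisner.
Variables (K : fieldType) (V : finType) (D : {set {set V}}).
Variables (d : nat) (a : 'I_d -> V -> K).

Definition theta i : {mpoly K[#|V|]} := \sum_u a i u *: var K u.

Definition red_gen (p : {mpoly K[#|V|]}) : Prop :=
  (exists2 A : {set V}, A \notin D & p = \prod_(u in A) var K u) \/
  (exists i, p = theta i).

Definition red_ideal := in_ideal red_gen.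

(** The contrapositive of [anisotropic], on homogeneous representatives, so that quotient rings can
    be left aside. *)
Definition anisotropic_over : Prop :=
  forall i, (i.*2 <= d)%N -> forall p : {mpoly K[#|V|]}, p \is i.-homog ->
  p ^+ 2 \in red_ideal -> p \in red_ideal.

Lemma nonface_red A : A \notin D -> \prod_(u in A) var K u \in red_ideal.
Proof. by move=> AD; apply: in_ideal_gen; left; exists A. Qed.

Lemma theta_red i : theta i \in red_ideal.
Proof. by apply: in_ideal_gen; right; exists i. Qed.

End StanleyReisner.

Section Homogeneity.
Variables (n m : nat) (R S : comNzRingType).
Variable (f : {rmorphism R -> {mpoly S[m]}}).
Variable h : 'I_n -> {mpoly S[m]}.

Lemma mpolyC_homog (c : S) : (c%:MP : {mpoly S[m]}) \is 0.-homog.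
Proof. by rewrite -[X in X \is _]mulr1 mul_mpolyC dhomogZ ?dhomog1. Qed.

Lemma mmap_homog i p :
  (forall c, f c \is 0.-homog) -> (forall j, h j \is 1.-homog) ->
  p \is i.-homog -> mmap f h p \is i.-homog.
Proof.
move=> f0 h1 /dhomogP pi; rewrite /mmap big_seq; apply: rpred_sum => k /pi <-.
suff H : mmap1 h k \is (mdeg k).-homog by have := dhomogM (f0 p@_k) H; rewrite add0n.
rewrite /mmap1 mdegE; apply: (big_ind2 (fun (q : {mpoly S[m]}) e => q \is e.-homog)).
- exact: dhomog1.
- by move=> ? ? ? ?; apply: dhomogM.
- by move=> j _; have := dhomogMn (k j) (h1 j); rewrite mul1n.
Qed.

End Homogeneity.

(** * Comparison with the quotients that define anisotropy *)

Section Transfer.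
Variables (K : fieldType) (V : finType) (D : {set {set V}}).
Variables (d : nat) (a : 'I_d -> V -> K).

Local Notation m := #|vertices D|.

Definition vertex_forms (i : 'I_d) : {mpoly K[m]} :=
  \sum_(j < m) a i (enum_val j) *: 'X_j.

Lemma reduction_eq0 (Theta : 'I_d -> {mpoly K[m]}) p :
  quot_proj (parameter Theta) (face_ring_proj p) = 0 <->
  p \in in_ideal (fun q => nonface_monomial q \/ exists i, q = Theta i).
Proof.
rewrite quot_proj0.
have -> : parameter Theta =
    fun u => exists2 t, (exists i, t = Theta i) & u = face_ring_proj t.
  apply/funext => u; apply/propext; split=> [[i ->]|[_ [i ->] ->]].
    by exists (Theta i) => //; exists i.
  by exists i.
by rewrite -quot_proj0; apply: in_ideal_quot.
Qed.

Definition to_var : {mpoly K[m]} -> {mpoly K[#|V|]} :=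
  mmap (@mpolyC _ _) (fun j => var K (enum_val j)).
HB.instance Definition _ := GRing.RMorphism.on to_var.

Definition of_var : {mpoly K[#|V|]} -> {mpoly K[m]} :=
  vmap (@mpolyC _ _)
    (fun u => if boolP (u \in vertices D) is AltTrue uD then 'X_(enum_rank_in uD u)
              else 0).
HB.instance Definition _ := GRing.RMorphism.on of_var.

Lemma to_varX j : to_var 'X_j = var K (enum_val j).
Proof. by rewrite /to_var mmapX mmap1U. Qed.

Lemma of_varX j : of_var (var K (enum_val j)) = 'X_j.
Proof.
rewrite /of_var vmapX; case: {-}_ / boolP => [jD|]; last by rewrite enum_valP.
by congr 'X_ _; apply: enum_valK_in.
Qed.

Lemma of_var0 u : u \notin vertices D -> of_var (var K u) = 0.
Proof. by move=> uD; rewrite /of_var vmapX; case: {-}_ / boolP => // uD'; rewrite uD' in uD. Qed.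

Lemma to_varK : cancel to_var of_var.
Proof.
elim/mpoly_ind_var => [c|p q IHp IHq|i p IH].
- by rewrite /to_var mmapC /of_var vmapC.
- by rewrite !rmorphD /= IHp IHq.
- by rewrite !rmorphM /= IH to_varX of_varX.
Qed.

Local Notation gens_m := (fun q => nonface_monomial q \/ exists i, q = vertex_forms i).
Local Notation J := (red_ideal D a).

Lemma to_var_homog i p : p \is i.-homog -> to_var p \is i.-homog.
Proof.
apply: mmap_homog => [c|j]; [exact: mpolyC_homog|exact: var_homog].
Qed.

Lemma of_var_homog i p : p \is i.-homog -> of_var p \is i.-homog.
Proof.
rewrite /of_var vmapE; apply: mmap_homog => [c|j] /=.
  exact: mpolyC_homog.
by case: {-}_ / boolP => [uD|_]; rewrite ?dhomog0 // dhomogX; apply/eqP/mdeg1.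
Qed.

Lemma var_nonvertex u : u \notin vertices D -> var K u \in J.
Proof.
rewrite inE => uD; have := nonface_red a uD.
by rewrite big_set1.
Qed.

Lemma to_var_ideal p : p \in in_ideal gens_m -> to_var p \in J.
Proof.
apply: (in_ideal_morph (f := to_var)) => h [[A AD ->]|[i ->]] /=.
  have := nonface_red a AD; rewrite big_imset /=; last by move=> ? ? _ _ /enum_val_inj.
  by rewrite rmorph_prod /= => AJ; under eq_bigr do rewrite to_varX.
have -> : to_var (vertex_forms i) = theta a i - \sum_(u | u \notin vertices D) a i u *: var K u.
  rewrite /theta (bigID (mem (vertices D))) /= addrK big_enum_val rmorph_sum.
  by apply: eq_bigr => j _ /=; rewrite -!mul_mpolyC rmorphM /= to_varX /to_var mmapC.
rewrite rpredB ?theta_red //; apply: rpred_sum => u uD; rewrite -mul_mpolyC.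
by apply/in_idealMr/var_nonvertex.
Qed.

Lemma of_var_ideal p : p \in J -> of_var p \in in_ideal gens_m.
Proof.
apply: (in_ideal_morph (f := of_var)) => h [[A AD ->]|[i ->]] /=.
  have [/subsetP AV|/subsetPn[u uA uV]] := boolP (A \subset vertices D); last first.
    by rewrite (bigD1 u) //= rmorphM /= of_var0 // mul0r rpred0.
  pose B : {set 'I_m} := [set j | enum_val j \in A].
  have AB : A = [set enum_val j | j in B].
    apply/setP => u; apply/idP/imsetP => [uA|[j jB ->]]; last by rewrite inE in jB.
    by exists (enum_rank_in (AV u uA) u); rewrite ?inE enum_rankK_in ?AV.
  apply: in_ideal_gen; left; exists B; first by rewrite -AB.
  rewrite rmorph_prod /= {1}AB big_imset /=; last by move=> ? ? _ _ /enum_val_inj.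
  by apply: eq_bigr => j _; rewrite of_varX.
apply: in_ideal_gen; right; exists i.
rewrite /theta (bigID (mem (vertices D))) /= rmorphD addrC rmorph_sum big1 ?add0r; last first.
  by move=> u uD; rewrite -mul_mpolyC rmorphM /= of_var0 ?mulr0.
rewrite big_enum_val rmorph_sum; apply: eq_bigr => j _ /=.
by rewrite -!mul_mpolyC rmorphM /= of_varX /of_var vmapC.
Qed.

Lemma of_varK p : p - to_var (of_var p) \in J.
Proof.
elim/mpoly_ind_vars: p => [c|p q IHp IHq|u p IH].
- by rewrite /of_var vmapC /to_var mmapC subrr rpred0.
- rewrite (rmorphD of_var) (rmorphD to_var). rewrite /= opprD addrACA; exact: rpredD IHp IHq.
- rewrite !rmorphM /=; have [uD|uD] := boolP (u \in vertices D); last first.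
    by rewrite of_var0 // rmorph0 mul0r subr0 in_idealMl ?var_nonvertex.
  rewrite -{1 2}(enum_rankK_in uD uD) of_varX to_varX -mulrBr.
  exact: in_idealMr.
Qed.

(** [to_var] and [of_var] preserve degrees, respect the two ideals and are inverse to each other
    modulo them, so both sides speak of the same graded ring. *)
Lemma anisotropic_vertex_forms :
  anisotropic vertex_forms <-> anisotropic_over D a.
Proof.
have J_of p : of_var p \in in_ideal gens_m -> p \in J.
  by move=> pJ; rewrite -(subrK (to_var (of_var p)) p) rpredD ?of_varK ?to_var_ideal.
split=> [an i id p pi p2 | an i id _ [p pi ->] u0 u2].
  apply: J_of; rewrite -reduction_eq0; apply: contrapT => u0.
  apply: (an i id _ _ u0); first by exists (of_var p) => //; apply: of_var_homog.
  have -> : forall q, quot_proj (parameter vertex_forms) (face_ring_proj (of_var q)) ^+ 2 =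
    quot_proj (parameter vertex_forms) (face_ring_proj (of_var (q ^+ 2))).
    by move=> q; rewrite /face_ring_proj (rmorphXn of_var) /= !(rmorphXn (quot_proj _)).
  exact: (iffRL (reduction_eq0 _ _) (of_var_ideal p2)).
apply: u0; apply/reduction_eq0; rewrite -(to_varK p); apply: of_var_ideal.
apply: (an i id); first exact: to_var_homog.
rewrite -(rmorphXn to_var); apply: to_var_ideal; apply/reduction_eq0.
by rewrite /face_ring_proj !(rmorphXn (quot_proj _)).
Qed.

End Transfer.

(** * Descent along field extensions *)

Section Descent.
Variables (k K : fieldType) (f : {rmorphism k -> K}).

Local Notation "p ^f" := (map_mpoly f p).

(** A linear system over k that is solvable over K is solvable over k ([map_submx]). The equations
    are indexed by the finitely many monomials below a common degree bound. *)
Lemma mpoly_span_descent n (p : {mpoly k[n]}) (c : seq (K * {mpoly k[n]})) :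
  p^f = \sum_(q <- c) q.1 *: q.2^f ->
  exists b : 'I_(size c) -> k, p = \sum_i b i *: (nth (0, 0) c i).2.
Proof.
move=> pc; pose w (i : 'I_(size c)) := (nth (0, 0) c i).2.
have [N pN wN] : exists2 N, (msize p <= N)%N & forall i, (msize (w i) <= N)%N.
  exists (maxn (msize p) (\max_i msize (w i))); first exact: leq_maxl.
  by move=> i; rewrite leq_max leq_bigmax ?orbT.
pose T : finType := 'X_{1..n < N}; pose mon (t : 'I_#|T|) : 'X_{1..n} := val (enum_val t).
pose W := \matrix_(i, t) (w i)@_(mon t); pose P := \row_t p@_(mon t).
have: (map_mx f P <= map_mx f W)%MS.
  apply/submxP; exists (\row_(i < size c) (nth (0, 0) c i).1).
  apply/rowP => t; rewrite !mxE -mcoeff_map_mpoly pc raddf_sum /=.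
  rewrite (big_nth (0, 0)) big_mkord; apply: eq_bigr => i _.
  by rewrite !mxE mcoeffZ mcoeff_map_mpoly.
rewrite map_submx => /submxP[B PB]; exists (B 0); apply/mpolyP => m.
rewrite raddf_sum /=; have [mN|mN] := ltnP (mdeg m) N.
  have := congr1 (fun M : 'rV_#|T| => M 0 (enum_rank (BMultinom mN : T))) PB.
  rewrite !mxE /mon enum_rankK /= => ->; apply: eq_bigr => i _.
  by rewrite !mxE mcoeffZ /mon enum_rankK.
rewrite (memN_msupp_eq0 (msize_mdeg_ge (leq_trans pN mN))) big1 // => i _.
by rewrite mcoeffZ (memN_msupp_eq0 (msize_mdeg_ge (leq_trans (wN i) mN))) mulr0.
Qed.

Section RedIdeal.
Variables (V : finType) (D : {set {set V}}) (d : nat) (a : 'I_d -> V -> k).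

Local Notation aK := (fun i u => f (a i u)).

Lemma map_var (u : V) : (var k u)^f = var K u.
Proof. exact: map_mpolyX. Qed.

Lemma map_theta i : (theta a i)^f = theta aK i.
Proof.
rewrite /theta raddf_sum; apply: eq_bigr => u _ /=.
by rewrite map_mpolyZ map_var.
Qed.

Lemma map_red_gen h : red_gen D aK h -> exists2 h', red_gen D a h' & h = h'^f.
Proof.
case=> [[A AD ->]|[i ->]].
  exists (\prod_(u in A) var k u); first by left; exists A.
  by rewrite rmorph_prod; apply: eq_bigr => u _ /=; rewrite map_var.
by exists (theta a i); [right; exists i|rewrite map_theta].
Qed.

Lemma red_ideal_map p : p \in red_ideal D a -> p^f \in red_ideal D aK.
Proof.
apply: (in_ideal_morph (f := map_mpoly f)) => h [[A AD ->]|[i ->]].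
  rewrite rmorph_prod /=; under eq_bigr do rewrite map_var.
  exact: nonface_red.
by rewrite /= map_theta; apply: theta_red.
Qed.

Lemma red_ideal_descent p : p^f \in red_ideal D aK -> p \in red_ideal D a.
Proof.
(* Expanding the multipliers into monomials shows that the ideal over K is the K-span of the ideal
   over k, which is the form that [mpoly_span_descent] can use. *)
move=> pJ; suff: forall x, x \in red_ideal D aK ->
    exists2 c : seq (K * {mpoly k[#|V|]}), (forall q, q \in c -> q.2 \in red_ideal D a) &
    x = \sum_(q <- c) q.1 *: q.2^f.
  move=> /(_ _ pJ)[c cJ /mpoly_span_descent[b ->]]; apply: rpred_sum => i _.
  by rewrite -mul_mpolyC; apply/in_idealMr/cJ/mem_nth.
apply: in_ideal_ind => [|x y [cx cxJ ->] [cy cyJ ->]|g h /map_red_gen[h' h'J ->]].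
- by exists [::]; rewrite ?big_nil.
- exists (cx ++ cy); last by rewrite big_cat.
  by move=> q; rewrite mem_cat => /orP[/cxJ|/cyJ].
- exists [seq (g@_m, 'X_[m] * h') | m <- msupp g].
    by move=> q /mapP[m _ ->]; apply/in_idealMr/in_ideal_gen.
  rewrite big_map {1}(mpolyE g) mulr_suml; apply: eq_bigr => m _ /=.
  by rewrite rmorphM /= map_mpolyX -scalerAl.
Qed.

Lemma anisotropic_descent : anisotropic_over D aK -> anisotropic_over D a.
Proof.
move=> an i id p pi p2; apply: red_ideal_descent; apply: (an i id).
  by apply: mmap_homog pi => [c|j]; [exact: mpolyC_homog|rewrite dhomogX; apply/eqP/mdeg1].
by rewrite -(rmorphXn (map_mpoly f)); apply: red_ideal_map.
Qed.

End RedIdeal.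
End Descent.

(** Columns at non-vertices may be changed freely, since their variables already lie in the ideal.
    This lets the column of v be filled in for [D]. *)
Lemma red_ideal_eq (K : fieldType) (V : finType) (D : {set {set V}}) d
    (a b : 'I_d -> V -> K) :
  (forall i u, u \in vertices D -> a i u = b i u) ->
  forall p, p \in red_ideal D a -> p \in red_ideal D b.
Proof.
move=> ab; apply: in_ideal_ext => h [[A AD ->]|[i ->]]; first exact: nonface_red.
have -> : theta a i = theta b i + \sum_u (a i u - b i u) *: var K u.
  rewrite /theta -big_split; apply: eq_bigr => u _ /=.
  by rewrite -scalerDl addrC subrK.
rewrite rpredD ?theta_red //; apply: rpred_sum => u _.
have [uD|uD] := boolP (u \in vertices D); first by rewrite ab // subrr scale0r rpred0.
by rewrite -mul_mpolyC; apply/in_idealMr/var_nonvertex.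
Qed.

Lemma anisotropic_eq (K : fieldType) (V : finType) (D : {set {set V}}) d
    (a b : 'I_d -> V -> K) :
  (forall i u, u \in vertices D -> a i u = b i u) ->
  anisotropic_over D a -> anisotropic_over D b.
Proof.
move=> ab an i id p pi p2; apply: (red_ideal_eq ab); apply: (an i id) => //.
by apply: red_ideal_eq p2 => j u uD; rewrite ab.
Qed.

(** * The face ring of a stellar subdivision *)

Section LineEvaluation.
Variables (K : fieldType) (V : finType) (e : V -> K).

(** Restriction to the line spanned by the point [e]: a form of degree i becomes its value at [e]
    times X^i. *)
Definition line_eval : {mpoly K[#|V|]} -> {poly K} :=
  vmap (@polyC K) (fun u => e u *: 'X).
HB.instance Definition _ := GRing.RMorphism.on line_eval.

Lemma line_evalC c : line_eval c%:MP = c%:P. Proof. exact: vmapC. Qed.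
Lemma line_evalX u : line_eval (var K u) = e u *: 'X. Proof. exact: vmapX. Qed.
Lemma line_evalZ c p : line_eval (c *: p) = c *: line_eval p.
Proof. by rewrite /line_eval vmapZ mul_polyC. Qed.

Lemma line_evalD p q : line_eval (p + q) = line_eval p + line_eval q.
Proof. exact: rmorphD. Qed.
Lemma line_evalM p q : line_eval (p * q) = line_eval p * line_eval q.
Proof. exact: rmorphM. Qed.

Lemma line_evalMX0 u p : (line_eval (var K u * p))`_0 = 0.
Proof. by rewrite line_evalM /= line_evalX -scalerAl coefZ coefXM mulr0. Qed.

Lemma line_eval_prod (A : {set V}) :
  line_eval (\prod_(u in A) var K u) = (\prod_(u in A) e u) *: 'X^#|A|.
Proof.
rewrite (rmorph_prod line_eval) /=; under eq_bigr do rewrite line_evalX -mul_polyC.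
by rewrite big_split prodr_const /= -rmorph_prod mul_polyC.
Qed.

Lemma line_eval_homog i p : p \is i.-homog -> exists r, line_eval p = r *: 'X^i.
Proof.
move=> /dhomogP pi; rewrite /line_eval vmapE /mmap big_seq.
apply: (big_ind (fun q : {poly K} => exists r, q = r *: 'X^i)).
- by exists 0; rewrite scale0r.
- by move=> _ _ [r ->] [r' ->]; exists (r + r'); rewrite scalerDl.
- move=> m /pi <-; exists (p@_m * \prod_j (e (enum_val j)) ^+ m j).
  suff -> : mmap1 ((fun u => e u *: 'X) \o enum_val) m =
      (\prod_j (e (enum_val j)) ^+ m j)%:P * 'X^(mdeg m).
    by rewrite mulrA -polyCM mul_polyC.
  rewrite /mmap1 mdegE (eq_bigr (fun j => (e (enum_val j) ^+ m j)%:P * 'X^(m j))); last first.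
    by move=> j _ /=; rewrite -mul_polyC exprMn polyC_exp.
  by rewrite big_split /= -rmorph_prod -prodrXr.
Qed.

End LineEvaluation.

Lemma homog0C (K : fieldType) n (p : {mpoly K[n]}) : p \is 0.-homog -> p = (p@_0%MM)%:MP.
Proof.
move=> p0; apply/mpolyP => m; rewrite mcoeffC; have [->|m0] := eqVneq m 0%MM.
  by rewrite mulr1.
by rewrite mulr0; apply: (dhomog_nemf_coeff p0); rewrite mdeg_eq0.
Qed.

Lemma anisotropic_degree0 (K : fieldType) (V : finType) (D : {set {set V}}) d
    (a : 'I_d -> V -> K) p :
  p \is 0.-homog -> p ^+ 2 \in red_ideal D a -> p \in red_ideal D a.
Proof.
move=> /homog0C ->; set c := p@_0%MM => c2; have [->|c0] := eqVneq c 0.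
  by rewrite mpolyC0 rpred0.
rewrite -[c](mulKf c0) -expr2 mpolyCM rmorphXn; exact: in_idealMr.
Qed.

Section Stellar.
Variables (K : fieldType) (V : finType) (D : {set {set V}}) (d : nat).
Variables (a : 'I_d -> V -> K) (s : {set V}) (v : V) (c : V -> K) (b : V -> 'I_d -> K).

Hypothesis Dcomplex : simplicial_complex D.
Hypothesis sfacet : facet D s.
Hypothesis vD : v \notin vertices D.
Hypothesis s_d : #|s| = d.
Hypothesis c_out : forall u, u \notin s -> c u = 0.
Hypothesis a_v : forall i, a i v = \sum_u a i u * c u.
Hypothesis b_dual : forall u w, u \in s -> w \in s -> \sum_i b u i * a i w = (u == w)%:R.

Local Notation D' := (bistellar0 D s v).
Local Notation J := (red_ideal D a).
Local Notation J' := (red_ideal D' a).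
Local Notation x := (var K).

Lemma facet_in : s \in D. Proof. exact: maxsetp sfacet. Qed.

Lemma v_notin (A : {set V}) : A \in D -> v \notin A.
Proof.
move=> AD; apply: contra vD => vA; rewrite inE.
by apply: (proj2 Dcomplex) AD _; rewrite sub1set.
Qed.

Lemma c_v : c v = 0. Proof. exact/c_out/v_notin/facet_in. Qed.

Lemma nonface_out (A : {set V}) : A \notin D -> exists2 w, w \in A & w \notin s.
Proof.
move=> AD; apply/subsetPn; apply: contra AD.
by apply: (proj2 Dcomplex); apply: facet_in.
Qed.

Lemma in_bistellar (A : {set V}) : v \notin A -> (A \in D') = (A \in D) && (A != s).
Proof.
move=> vA; rewrite !inE; have [AE|As] /= := eqVneq A s.
  rewrite AE properxx andbF /=; apply/imsetP => -[t _ st].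
  by move: vA; rewrite AE st setU11.
rewrite andbT; case: (boolP (A \in D)) => //= AD.
apply/orP => -[/proper_sub As'|/imsetP[t _ At]].
  by move: AD; rewrite (proj2 Dcomplex _ _ facet_in As').
by move: vA; rewrite At setU11.
Qed.

Lemma in_bistellar_v (t : {set V}) : v \notin t -> (v |: t \in D') = (t \proper s).
Proof.
move=> vt; rewrite !inE.
have /negPf -> : v |: t \notin D by apply/negP => /v_notin; rewrite setU11.
have /negPf -> : ~~ (v |: t \proper s).
  apply/negP => /proper_sub/subsetP/(_ v (setU11 _ _)).
  by apply/negP/v_notin/facet_in.
rewrite andbF /=; apply/imsetP/idP => [[t' t's tt']|ts]; last by exists t; rewrite ?inE.
rewrite inE in t's; suff -> : t = t' by [].
have vt' : v \notin t'.
  by apply: contra (v_notin facet_in); apply/subsetP/proper_sub.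
by rewrite -(setU1K vt) tt' setU1K.
Qed.

(** The vector [b u] is dual to the columns of [s], so this combination of the thetas solves for
    [x u] in terms of the variables outside [s]. *)
Lemma var_dual u : u \in s ->
  \sum_i (b u i)%:MP * theta a i =
  x u + \sum_(w | w \notin s) (\sum_i b u i * a i w)%:MP * x w.
Proof.
move=> us; have swap w : \sum_i (b u i)%:MP * (a i w *: x w) = (\sum_i b u i * a i w)%:MP * x w.
  rewrite rmorph_sum mulr_suml; apply: eq_bigr => i _ /=.
  by rewrite -mul_mpolyC mpolyCM mulrA.
rewrite /theta; under eq_bigr do rewrite mulr_sumr.
rewrite exchange_big /=; under eq_bigr do rewrite swap.
rewrite (bigID (mem s)) /= (bigD1 u) //= b_dual // eqxx mpolyC1 mul1r; congr (_ + _).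
rewrite [X in _ + X]big1 ?addr0 // => w /andP[ws wu].
by rewrite b_dual // eq_sym (negPf wu) mpolyC0 mul0r.
Qed.

Lemma var_v_in : x v \in J.
Proof. exact: var_nonvertex. Qed.

(** The monomial of a facet is a socle element. A variable outside [s] completes it to a nonface;
    one inside [s] is, by [var_dual], a combination of outside ones. *)
Lemma var_facet u : x u * \prod_(w in s) x w \in J.
Proof.
have out w : w \notin s -> x w * \prod_(w in s) x w \in J.
  move=> ws; rewrite -(big_setU1 _ ws) /=; apply: nonface_red.
  apply: contra ws => wsD; have <- := maxsetsup sfacet wsD (subsetUr _ _).
  exact: setU11.
have [us|] := boolP (u \in s); last exact: out.
have /eqP := var_dual us; rewrite -subr_eq => /eqP <-; rewrite mulrBl rpredB //.
  by apply: in_idealMl; apply: rpred_sum => i _; apply/in_idealMr/theta_red.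
rewrite mulr_suml; apply: rpred_sum => w ws; rewrite -mulrA.
by apply/in_idealMr/out.
Qed.

Lemma var_cone_out u : u \notin s -> u != v -> x u * x v \in J'.
Proof.
move=> us uv; have: \prod_(w in v |: [set u]) x w \in J'.
  apply: nonface_red; rewrite in_bistellar_v ?inE 1?eq_sym //.
  by apply: contra us => /proper_sub; rewrite sub1set.
by rewrite big_setU1 ?big_set1 /= 1?mulrC // inE eq_sym.
Qed.

(* Multiplied by [x v], this form vanishes modulo J'. *)
Definition pulled u := x u + c u *: x v.

(** In [var_dual], multiplication by [x v] kills every outside variable except [x v] itself, whose
    coefficient is [c u] because [c] gives the coordinates of the column of [v]. *)
Lemma pulled_cone u : u != v -> pulled u * x v \in J'.
Proof.
move=> uv; have [us|us] := boolP (u \in s); last first.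
  by rewrite /pulled c_out // scale0r addr0 var_cone_out.
have sv := v_notin facet_in.
have cu : \sum_i b u i * a i v = c u.
  under eq_bigr do rewrite a_v mulr_sumr.
  rewrite exchange_big /=.
  rewrite (eq_bigr (fun w => (\sum_i b u i * a i w) * c w)); last first.
    by move=> w _; rewrite mulr_suml; apply: eq_bigr => i _; rewrite mulrA.
  rewrite (bigD1 u) //= b_dual // eqxx mul1r [X in _ + X]big1 ?addr0 // => w wu.
  have [ws|ws] := boolP (w \in s); last by rewrite c_out // mulr0.
  by rewrite b_dual // eq_sym (negPf wu) mul0r.
have := var_dual us; rewrite (bigD1 v) //= cu addrA mul_mpolyC => /eqP.
rewrite -subr_eq /pulled => /eqP <-; rewrite mulrBl rpredB //.
  by apply: in_idealMl; apply: rpred_sum => i _; apply/in_idealMr/theta_red.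
rewrite mulr_suml; apply: rpred_sum => w /andP[ws wv]; rewrite -mulrA.
by apply/in_idealMr/var_cone_out.
Qed.

(* The quotient by J' is the quotient by J with a variable [t = x v] adjoined,
   subject to [x u * t = 0] for all u and to a relation expressing the socle
   element [t ^+ d] through the monomial of s: [pull] embeds the first summand,
   [kill_v] and [line] are the projections of a polynomial to the quotient by J
   and to the powers of t. *)
Definition pull : {mpoly K[#|V|]} -> {mpoly K[#|V|]} :=
  vmap (@mpolyC _ _) (fun u => if u == v then 0 else pulled u).
HB.instance Definition _ := GRing.RMorphism.on pull.

Lemma pullD p q : pull (p + q) = pull p + pull q.
Proof. exact: rmorphD. Qed.
Lemma pullM p q : pull (p * q) = pull p * pull q.
Proof. exact: rmorphM. Qed.

Lemma pullX u : u != v -> pull (x u) = pulled u.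
Proof. by move=> uv; rewrite /pull vmapX (negPf uv). Qed.
Lemma pullXv : pull (x v) = 0.
Proof. by rewrite /pull vmapX eqxx. Qed.
Lemma pullC e : pull e%:MP = e%:MP.
Proof. exact: vmapC. Qed.

(** The terms [c u *: x v] of the pulled variables add up to the term in [x v], by [a_v]. *)
Lemma pull_theta i : pull (theta a i) = theta a i.
Proof.
rewrite /theta (rmorph_sum pull) /=.
rewrite (eq_bigr (fun u => a i u *: (if u == v then 0 else pulled u))); last first.
  by move=> u _; rewrite /pull vmapZ vmapX mul_mpolyC.
have av : a i v = \sum_(u | u != v) a i u * c u.
  by rewrite a_v (bigD1 v) //= c_v mulr0 add0r.
rewrite (bigD1 v) //= eqxx scaler0 add0r [RHS](bigD1 v) //= av scaler_suml -big_split.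
apply: eq_bigr => u uv /=.
by rewrite (negPf uv) scalerDr scalerA addrC.
Qed.

(** A variable off the closed star of [v] annihilates [x v], so it does not see the difference
    between [x u] and [pulled u]. *)
Lemma pull_prod w (P : pred V) : w \notin s -> w != v ->
  x w * (\prod_(u | P u) pulled u - \prod_(u | P u) x u) \in J'.
Proof.
move=> ws wv; apply: (big_ind2 (fun y z => x w * (y - z) \in J')).
- by rewrite subrr mulr0 rpred0.
- move=> y1 z1 y2 z2 h1 h2.
  have -> : x w * (y1 * y2 - z1 * z2) = y2 * (x w * (y1 - z1)) + z1 * (x w * (y2 - z2)) by ring.
  by rewrite rpredD // in_idealMr.
- move=> u _; rewrite /pulled addrAC subrr add0r -mul_mpolyC mulrCA.
  by apply/in_idealMr/var_cone_out.
Qed.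

(** A nonface of [D] has a vertex w outside [s]. There [pulled w] is [x w], and [pull_prod] reduces
    the image to the monomial of a nonface of [D']. *)
Lemma pull_ideal p : p \in J -> pull p \in J'.
Proof.
apply: (in_ideal_morph (f := pull)) => h [[A AD ->]|[i ->]]; last first.
  by rewrite /= pull_theta; apply: theta_red.
rewrite (rmorph_prod pull) /=; have [vA|vA] := boolP (v \in A).
  by rewrite (bigD1 v) //= pullXv mul0r rpred0.
have [w wA ws] := nonface_out AD.
have wv : w != v by apply: contraNneq vA => <-.
rewrite (eq_bigr pulled); last first.
  by move=> u uA; apply/pullX; apply: contraNneq vA => <-.
have: \prod_(u in A) x u \in J'.
  by apply: nonface_red; rewrite in_bistellar // (negPf AD).
rewrite (bigD1 w) //= => xA; rewrite (bigD1 w) //=.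
have -> : pulled w = x w by rewrite /pulled c_out // scale0r addr0.
have := rpredD (pull_prod (fun u => (u \in A) && (u != w)) ws wv) xA.
by rewrite mulrBr subrK.
Qed.

Definition kill_v : {mpoly K[#|V|]} -> {mpoly K[#|V|]} :=
  vmap (@mpolyC _ _) (fun u => if u == v then 0 else x u).
HB.instance Definition _ := GRing.RMorphism.on kill_v.

Lemma kill_vD p q : kill_v (p + q) = kill_v p + kill_v q.
Proof. exact: rmorphD. Qed.
Lemma kill_vM p q : kill_v (p * q) = kill_v p * kill_v q.
Proof. exact: rmorphM. Qed.

Lemma kill_vX u : u != v -> kill_v (x u) = x u.
Proof. by move=> uv; rewrite /kill_v vmapX (negPf uv). Qed.
Lemma kill_vXv : kill_v (x v) = 0.
Proof. by rewrite /kill_v vmapX eqxx. Qed.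
Lemma kill_vC e : kill_v e%:MP = e%:MP.
Proof. exact: vmapC. Qed.

Lemma kill_v_homog i p : p \is i.-homog -> kill_v p \is i.-homog.
Proof.
rewrite /kill_v vmapE; apply: mmap_homog => [e|j] /=; first exact: mpolyC_homog.
by case: ifP => _; [exact: dhomog0|exact: var_homog].
Qed.

Lemma kill_v_congr p : kill_v p - p \in J.
Proof.
elim/mpoly_ind_vars: p => [e|p q IHp IHq|u p IH].
- by rewrite kill_vC subrr rpred0.
- by rewrite kill_vD /= opprD addrACA; apply: rpredD.
- rewrite kill_vM /=; have [->|uv] := eqVneq u v.
    by rewrite kill_vXv mul0r sub0r rpredN; apply/in_idealMl/var_v_in.
  by rewrite kill_vX // -mulrBr; apply: in_idealMr.
Qed.

(** The point where [x v] is 1 and all pulled variables vanish; by [a_v] the thetas vanish there as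
    well. *)
Definition coord u : K := if u == v then 1 else - c u.
Local Notation line := (line_eval coord).

Lemma line_pull p : exists e, line (pull p) = e%:P.
Proof.
elim/mpoly_ind_vars: p => [e|p q [e IHp] [e' IHq]|u p [e IH]].
- by exists e; rewrite pullC line_evalC.
- by exists (e + e'); rewrite pullD line_evalD /= IHp IHq polyCD.
- exists 0; rewrite pullM line_evalM /=; have [->|uv] := eqVneq u v.
    by rewrite pullXv (rmorph0 line) mul0r polyC0.
  rewrite pullX // line_evalD /= line_evalZ !line_evalX /coord eqxx (negPf uv).
  by rewrite scale1r scaleNr addNr mul0r polyC0.
Qed.

Lemma kill_v_pull p : kill_v (pull p) = kill_v p.
Proof.
elim/mpoly_ind_vars: p => [e|p q IHp IHq|u p IH].
- by rewrite pullC.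
- rewrite pullD kill_vD kill_vD /=.
  by rewrite IHp IHq.
- rewrite pullM kill_vM.
  rewrite kill_vM /= IH; congr (_ * _).
  have [->|uv] := eqVneq u v; first by rewrite pullXv (rmorph0 kill_v) kill_vXv.
  rewrite pullX // kill_vD /= -mul_mpolyC.
  by rewrite kill_vM /= kill_vXv mulr0 addr0.
Qed.

(* [t ^+ d = socle_coef * pull (\prod_(u in s) x u)] modulo J'. *)
Definition socle_coef : K := - (\prod_(u in s) - c u)^-1.

Hypothesis c_neq0 : forall u, u \in s -> c u != 0.

Lemma coord_prod : \prod_(u in s) coord u = \prod_(u in s) - c u.
Proof.
apply: eq_bigr => u us; rewrite /coord ifN //.
by apply: contraTneq us => ->; apply/v_notin/facet_in.
Qed.

Lemma socle_coefK : (\prod_(u in s) coord u) * socle_coef = -1.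
Proof.
rewrite coord_prod mulrN mulfV //; apply/prodf_neq0 => u us.
by rewrite oppr_eq0 c_neq0.
Qed.

Lemma facet_mul p : kill_v p * \prod_(u in s) x u - (line p)`_0 *: \prod_(u in s) x u \in J.
Proof.
elim/mpoly_ind_vars: p => [e|p q IHp IHq|u p IH].
- by rewrite kill_vC line_evalC coefC /= mul_mpolyC subrr rpred0.
- rewrite kill_vD line_evalD /= mulrDl coefD scalerDl opprD addrACA.
  exact: rpredD.
- rewrite line_evalMX0 scale0r subr0 kill_vM /=; have [->|uv] := eqVneq u v.
    by rewrite kill_vXv !mul0r rpred0.
  by rewrite kill_vX // mulrAC; apply/in_idealMl/var_facet.
Qed.

(** This makes the two projections well defined on the quotient by J': powers of t below d are
    independent of the image of the first summand, and t^d is traded for the facet monomial. It is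
    checked on one generator at a time. *)
Lemma stellar_ideal p : p \in J' ->
  (forall j, (j < d)%N -> (line p)`_j = 0) /\
  kill_v p + ((line p)`_d * socle_coef) *: \prod_(u in s) x u \in J.
Proof.
move: p; apply: in_ideal_ind => [|p q [p0 pJ] [q0 qJ]|g h gen].
- split=> [j _|]; first by rewrite (rmorph0 line) coef0.
  by rewrite (rmorph0 kill_v) (rmorph0 line) coef0 mul0r scale0r addr0 rpred0.
- split=> [j jd|]; first by rewrite line_evalD coefD p0 ?q0 ?addr0.
  rewrite line_evalD kill_vD /= coefD mulrDl scalerDl addrACA.
  exact: rpredD.
(* Covers every generator invisible on the line, that is, all but those of [v |: s] and [s]. *)
have zero : line h = 0 -> kill_v h \in J ->
    (forall j, (j < d)%N -> (line (g * h))`_j = 0) /\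
    kill_v (g * h) + ((line (g * h))`_d * socle_coef) *: \prod_(u in s) x u \in J.
  move=> lh kh; rewrite line_evalM kill_vM /= lh mulr0; split=> [j _|].
    by rewrite coef0.
  by rewrite coef0 mul0r scale0r addr0; apply: in_idealMr.
have line_out (A : {set V}) w : w \in A -> w \notin s -> w != v -> line (\prod_(u in A) x u) = 0.
  move=> wA ws wv; rewrite line_eval_prod (bigD1 w) //= /coord (negPf wv) c_out //.
  by rewrite oppr0 mul0r scale0r.
case: gen => [[A AD' ->]|[i ->]] in zero *; last first.
  apply: zero; last first.
    rewrite -(subrK (theta a i) (kill_v _)); apply: rpredD; last exact: theta_red.
    exact: kill_v_congr.
  rewrite /theta (rmorph_sum line) /=.
  under eq_bigr do rewrite line_evalZ line_evalX scalerA.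
  rewrite -scaler_suml (bigD1 v) //= /coord eqxx mulr1 a_v (bigD1 v) //= c_v mulr0 add0r.
  rewrite -big_split /= big1 ?scale0r // => u uv.
  by rewrite (negPf uv) mulrN subrr.
have [vA|vA] := boolP (v \in A).
  have [[w /setD1P[wv wA] ws]|As] := pselect (exists2 w, w \in A :\ v & w \notin s).
    apply: zero; first exact: line_out wA ws wv.
    by rewrite (rmorph_prod kill_v) /= (bigD1 v) //= kill_vXv mul0r rpred0.
  (* The monomial of this nonface restricts to degree d + 1 on the line and so contributes nothing
     up to degree d. *)
  have AE : A = v |: s.
    rewrite -(setD1K vA); congr (_ |: _); apply/eqP; rewrite eqEproper.
    have -> : A :\ v \subset s by apply: contrapT => /negP/subsetPn.
    by rewrite -in_bistellar_v ?setD1K // !inE eqxx.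
  have vs := v_notin facet_in.
  have lE : line (g * \prod_(u in A) x u) =
     (line g * (\prod_(u in A) coord u)%:P) * 'X^(d.+1).
    by rewrite line_evalM /= line_eval_prod -mul_polyC mulrA AE cardsU1 vs s_d.
  rewrite lE coefMXn ltnSn mul0r scale0r addr0; split=> [j jd|].
    by rewrite coefMXn ltnS ltnW.
  rewrite kill_vM (rmorph_prod kill_v) /= (bigD1 v) //= kill_vXv mul0r mulr0.
  exact: rpred0.
have kA : kill_v (\prod_(u in A) x u) = \prod_(u in A) x u.
  rewrite (rmorph_prod kill_v); apply: eq_bigr => u uA /=.
  by rewrite kill_vX //; apply: contraNneq vA => <-.
have [AD|AD] := boolP (A \in D); last first.
  have [w wA ws] := nonface_out AD; apply: zero; last by rewrite kA; apply: nonface_red.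
  by apply: (line_out A w) => //; apply: contraNneq vA => <-.
(* The facet [s] is the only face of [D] that is lost. Its monomial survives under both projections,
   and [socle_coefK] makes the two contributions cancel. *)
have AE : A = s by apply/eqP; move: AD'; rewrite in_bistellar // AD negbK.
have lE : line (g * \prod_(u in A) x u) = (line g * (\prod_(u in s) coord u)%:P) * 'X^d.
  by rewrite line_evalM /= line_eval_prod -mul_polyC mulrA AE s_d.
rewrite lE coefMXn ltnn subnn coefMC -(mulrA _`_0) socle_coefK mulrN1 scaleNr; split=> [j jd|].
  by rewrite coefMXn jd.
rewrite kill_vM /= kA AE; exact: facet_mul.
Qed.

Definition on_line : {poly K} -> {mpoly K[#|V|]} := horner_alg (x v).
HB.instance Definition _ := GRing.RMorphism.on on_line.

Lemma on_lineD p q : on_line (p + q) = on_line p + on_line q.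
Proof. exact: rmorphD. Qed.
Lemma on_lineM p q : on_line (p * q) = on_line p * on_line q.
Proof. exact: rmorphM. Qed.

Lemma on_lineC e : on_line e%:P = e%:MP.
Proof. by rewrite /on_line horner_algC alg_mpolyC. Qed.

Lemma on_lineX : on_line 'X = x v.
Proof. exact: horner_algX. Qed.

Lemma on_line_coef0 q : exists r, on_line q - (q`_0)%:MP = r * x v.
Proof.
elim/poly_ind: q => [|q e [r IH]].
  by exists 0; rewrite (rmorph0 on_line) coef0 mpolyC0 subrr mul0r.
exists (on_line q); rewrite on_lineD on_lineM /= on_lineC on_lineX.
by rewrite coefD coefMX coefC eqxx /= add0r addrK.
Qed.

(** Since [x v] annihilates the pulled variables, only the constant term of [p] acts on it. *)
Lemma var_v_pull p : x v * (pull (kill_v p) - ((line p)`_0)%:MP) \in J'.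
Proof.
elim/mpoly_ind_vars: p => [e|p q IHp IHq|u p IH].
- by rewrite kill_vC pullC line_evalC coefC /= subrr mulr0 rpred0.
- rewrite kill_vD pullD line_evalD /=.
  by rewrite coefD mpolyCD opprD addrACA mulrDr; apply: rpredD.
- rewrite line_evalMX0 mpolyC0 subr0 kill_vM.
  rewrite pullM /=; have [->|uv] := eqVneq u v.
    by rewrite kill_vXv (rmorph0 pull) mul0r mulr0 rpred0.
  by rewrite kill_vX // pullX // mulrA [x v * _]mulrC; apply/in_idealMl/pulled_cone.
Qed.

(** The two parts span the quotient. The constant term occurs in both, hence the correction. *)
Lemma stellar_decomposition p :
  p - pull (kill_v p) - on_line (line p) + ((line p)`_0)%:MP \in J'.
Proof.
elim/mpoly_ind_vars: p => [e|p q IHp IHq|u p IH].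
- by rewrite kill_vC pullC line_evalC coefC /= on_lineC subrr sub0r addNr rpred0.
- rewrite kill_vD pullD line_evalD /=.
  rewrite on_lineD /= coefD mpolyCD.
  apply: in_ideal_eq (rpredD IHp IHq) _.
  move: (pull _) (pull _) (on_line _) (on_line _) (_%:MP) (_%:MP) => *; ring.
- rewrite line_evalMX0 mpolyC0 addr0 kill_vM.
  rewrite pullM line_evalM /= line_evalX.
  rewrite -mul_polyC -mulrA !on_lineM.
  rewrite on_lineC on_lineX; have [->|uv] := eqVneq u v.
    rewrite kill_vXv (rmorph0 pull) mul0r subr0 /coord eqxx mpolyC1 mul1r -mulrBr.
    apply: in_ideal_eq (rpredD (in_idealMr (x v) IH) (var_v_pull p)) _.
    move: (pull _) (on_line _) (_%:MP) => *; ring.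
  rewrite kill_vX // pullX // /coord (negPf uv) mpolyCN.
  have [r rE] := on_line_coef0 (line p).
  have := in_idealMr r (pulled_cone uv); rewrite mulrCA -rE => PE.
  have PV := in_idealMr (c u)%:MP (var_v_pull p).
  apply: in_ideal_eq (rpredB (rpredD (in_idealMr (x u) IH) PE) PV) _.
  rewrite /pulled -mul_mpolyC.
  move: (pull _) (on_line _) (_`_0)%:MP (c u)%:MP => *; ring.
Qed.

Lemma anisotropic_unstellar : anisotropic_over D' a -> anisotropic_over D a.
Proof.
move=> an [_|i id] p pi p2; first exact: anisotropic_degree0.
have d0 : (0 < d)%N by apply: leq_trans id; rewrite doubleS.
have pull_homog : pull p \is i.+1.-homog.
  rewrite /pull vmapE; apply: mmap_homog pi => [e|j] /=; first exact: mpolyC_homog.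
  case: ifP => _; first exact: dhomog0.
  by rewrite dhomogD ?dhomogZ ?var_homog.
have pull_in : pull p \in J'.
  apply: (an _ id _ pull_homog); rewrite expr2 -pullM -expr2; exact: pull_ideal.
(* Injectivity of [pull] modulo the ideals: a pulled polynomial is constant on the line, so its
   coefficient at d > 0 is zero and the facet term of [stellar_ideal] disappears. *)
have [_] := stellar_ideal pull_in.
have [e ->] := line_pull p; rewrite coefC gtn_eqF // mul0r scale0r addr0 kill_v_pull => kJ.
by rewrite -(subKr (kill_v p) p); apply: rpredB => //; apply: kill_v_congr.
Qed.

Lemma anisotropic_stellar :
  (forall i q, (0 < i)%N -> (i.*2 < d)%N -> q \is i.-homog -> q ^+ 2 \in J -> q \in J) ->
  (forall i q r, (0 < i)%N -> i.*2 = d -> q \is i.-homog ->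
    q ^+ 2 + (r ^+ 2 * socle_coef) *: \prod_(u in s) x u \in J -> q \in J /\ r = 0) ->
  anisotropic_over D' a.
Proof.
move=> an_lt an_eq [_|i id] p pi p2; first exact: anisotropic_degree0.
have [r lE] := line_eval_homog coord pi; have ki := kill_v_homog pi.
have [lo hi] := stellar_ideal p2.
have l2 : line (p ^+ 2) = r ^+ 2 *: 'X^(i.+1.*2).
  by rewrite expr2 line_evalM -expr2 lE exprZn -exprM muln2.
rewrite l2 expr2 kill_vM -expr2 coefZ coefXn /= in hi.
suff [kJ r0] : kill_v p \in J /\ r = 0.
  have := stellar_decomposition p; rewrite lE r0 scale0r (rmorph0 on_line) coef0.
  rewrite mpolyC0 addr0 subr0 => pJ; rewrite -(subrK (pull (kill_v p)) p).
  by apply: rpredD => //; apply: pull_ideal.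
move: id; rewrite leq_eqVlt => /orP[/eqP id|id].
  have dE : d == i.+1.*2 by rewrite -id.
  by rewrite dE mulr1 in hi; apply: (an_eq _ _ _ _ id ki hi).
(* Below the middle degree the socle relation does not intervene: the facet term drops out of [hi],
   and [lo] gives r^2 = 0 on its own. *)
rewrite gtn_eqF // mulr0 mul0r scale0r addr0 in hi.
split; first exact: (an_lt _ _ _ id ki hi).
have := lo _ id; rewrite l2 coefZ coefXn eqxx mulr1 => /eqP.
by rewrite expf_eq0 /= => /eqP.
Qed.

End Stellar.

(** * Purely transcendental extensions *)

Lemma seq_max (disp : Order.disp_t) (T : orderType disp) (r : seq T) y :
  y \in r -> exists2 x, x \in r & forall z, z \in r -> (z <= x)%O.
Proof.
elim: r y => // w r IH y _; case: r IH => [|w' r] IH.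
  by exists w => [|z]; rewrite ?inE ?eqxx // => /eqP ->.
have [x xr xmax] := IH w' (mem_head _ _); have [wx|xw] := leP w x.
  by exists x => [|z]; rewrite inE ?xr ?orbT // => /predU1P[->|/xmax].
exists w => [|z]; first by rewrite inE eqxx.
by rewrite inE => /predU1P[->|/xmax/le_trans] //; apply; apply: ltW.
Qed.

Section LeadModulo.
Variables (N : nat) (P : comNzRingType) (S : P -> Prop).
Local Notation J := (in_ideal S).
Implicit Types f g : {mpoly P[N]}.

(** m is the leading exponent of [f] once its coefficients are reduced modulo J. *)
Definition lead_mod f m := f@_m \notin J /\ forall m', (m < m')%O -> f@_m' \in J.

Lemma lead_mod_exists f m : f@_m \notin J -> exists m', lead_mod f m'.
Proof.
move=> fm; have mr : m \in [seq m' <- msupp f | f@_m' \notin J].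
  rewrite mem_filter fm mcoeff_msupp; apply: contraNneq fm => ->; exact: rpred0.
have [m' m'r m'max] := seq_max mr; exists m'.
split=> [|l ml]; first by move: m'r; rewrite mem_filter => /andP[].
have [lf|/memN_msupp_eq0 ->] := boolP (l \in msupp f); last exact: rpred0.
apply: contraLR ml => lJ; rewrite -leNgt; apply: m'max.
by rewrite mem_filter lJ.
Qed.

(** The quotient by J may have zero divisors, so the product of the leading coefficients has to be
    assumed nonzero there; for squares, anisotropy provides this. *)
Lemma lead_modM f g m l : lead_mod f m -> lead_mod g l ->
  f@_m * g@_l \notin J -> lead_mod (f * g) (m + l)%MM.
Proof.
move=> [fm fJ] [gl gJ] fg.
have prod_in k1 k2 : (m < k1)%O || (l < k2)%O -> f@_k1 * g@_k2 \in J.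
  by case/orP => [/fJ|/gJ]; [apply: in_idealMl|apply: in_idealMr].
split; last first.
  move=> k mk; rewrite mcoeffM; apply: rpred_sum => -[k1 k2] /= /eqP kE; apply: prod_in.
  apply: contraLR mk; rewrite negb_or -!leNgt => /andP[k1m k2l].
  by have := lem_add k1m k2l; rewrite -kE.
rewrite mcoeffM; set B := (mdeg _).+1.
have mB : (mdeg m < B)%N by rewrite ltnS mdegD leq_addr.
have lB : (mdeg l < B)%N by rewrite ltnS mdegD leq_addl.
rewrite (bigD1 (BMultinom mB, BMultinom lB)) //= rpredDr //.
apply: rpred_sum => -[[k1 k1B] [k2 k2B]] /andP[/= /eqP kE kne]; apply: prod_in.
apply: contraR kne; rewrite negb_or -!leNgt => /andP[k1m k2l].
suff [k1E k2E] : k1 = m /\ k2 = l by apply/eqP; congr (_, _); apply: val_inj.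
have k1E : k1 = m.
  apply/eqP; rewrite eq_le k1m leNgt; apply/negP => k1m'.
  by have := ltmc_le_add k1m' k2l; rewrite kE ltxx.
by split=> //; move: kE; rewrite k1E => /addmI.
Qed.

Lemma lead_modD f g m l : lead_mod f m -> lead_mod g l ->
  (forall k, (f + g)@_k \in J) -> m = l.
Proof.
move=> [fm fJ] [gl gJ] fgJ; apply/eqP; rewrite eq_le !leNgt; apply/andP; split; apply/negP.
  by move/gJ => gm; move: fm; rewrite -(rpredDr _ gm) -mcoeffD fgJ.
by move/fJ => fl; move: gl; rewrite -(rpredDl _ fl) -mcoeffD fgJ.
Qed.

Lemma lead_mod_const c : c \notin J -> lead_mod c%:MP 0%MM.
Proof.
move=> cJ; split; rewrite ?mcoeffC ?eqxx ?mulr1 // => m m0.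
by rewrite mcoeffC gt_eqF // mulr0; apply: rpred0.
Qed.

Lemma lead_modX m : 1 \notin J -> lead_mod 'X_[m] m.
Proof.
move=> J1; split=> [|l ml]; rewrite mcoeffX ?eqxx // lt_eqF //; exact: rpred0.
Qed.

End LeadModulo.

Lemma fraction_repr (R : idomainType) (x : {fraction R}) :
  FracField.tofrac (frac (repr x)).2 * x = FracField.tofrac (frac (repr x)).1.
Proof.
rewrite -{2}[x]reprK !piE; apply/eqP; rewrite piE /= FracField.equivfE /=.
by rewrite /FracField.mulf !numden_Ratio ?mul1r ?oner_eq0 ?denom_ratioP // mulr1.
Qed.

Section FractionCoefficients.
Variables (n N : nat) (k : fieldType).

Local Notation P := {mpoly k[n]}.
Local Notation R := {mpoly k[N]}.
Local Notation K := {fraction R}.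
Local Notation tofrac := (@FracField.tofrac R).

Definition const_frac (e : k) : K := tofrac e%:MP.
HB.instance Definition _ := GRing.RMorphism.copy const_frac (tofrac \o @mpolyC N k).

(* A polynomial in the indeterminates c with coefficients in k[X], read in k(c)[X]. *)
Fact swap_key : unit. Proof. exact: tt. Qed.
Definition swap_frac : {mpoly P[N]} -> {mpoly K[n]} :=
  locked_with swap_key (mmap (map_mpoly const_frac) (fun l => (tofrac 'X_l)%:MP)).

Lemma swap_fracE : swap_frac = mmap (map_mpoly const_frac) (fun l => (tofrac 'X_l)%:MP).
Proof. exact: locked_withE. Qed.

Fact swap_frac_is_zmod_morphism : zmod_morphism swap_frac.
Proof. by rewrite swap_fracE; apply: raddfB. Qed.
HB.instance Definition _ := GRing.isZmodMorphism.Build _ _ swap_frac swap_frac_is_zmod_morphism.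
Fact swap_frac_is_monoid_morphism : monoid_morphism swap_frac.
Proof. by rewrite swap_fracE; split=> [|p q]; rewrite ?rmorph1 ?rmorphM. Qed.
HB.instance Definition _ := GRing.isMonoidMorphism.Build _ _ swap_frac swap_frac_is_monoid_morphism.

Lemma swap_fracD f g : swap_frac (f + g) = swap_frac f + swap_frac g.
Proof. exact: rmorphD. Qed.
Lemma swap_fracM f g : swap_frac (f * g) = swap_frac f * swap_frac g.
Proof. exact: rmorphM. Qed.

Lemma swap_fracC p : swap_frac p%:MP = map_mpoly const_frac p.
Proof. by rewrite swap_fracE mmapC. Qed.

Lemma swap_fracX m : swap_frac 'X_[m] = (tofrac 'X_[m])%:MP.
Proof.
rewrite swap_fracE mmapX /mmap1 mpolyXE_id rmorph_prod rmorph_prod /=.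
by apply: eq_bigr => l _; rewrite !rmorphXn.
Qed.

Definition coefwise : R -> {mpoly P[N]} := locked_with swap_key (map_mpoly (@mpolyC n k)).

Lemma coefwiseE : coefwise = map_mpoly (@mpolyC n k).
Proof. exact: locked_withE. Qed.

Lemma coefwiseD g h : coefwise (g + h) = coefwise g + coefwise h.
Proof. by rewrite coefwiseE; apply: rmorphD. Qed.
Lemma coefwiseM g h : coefwise (g * h) = coefwise g * coefwise h.
Proof. by rewrite coefwiseE; apply: rmorphM. Qed.
Lemma coefwiseX m : coefwise 'X_[m] = 'X_[m].
Proof. by rewrite coefwiseE map_mpolyX. Qed.
Lemma mcoeff_coefwise g m : (coefwise g)@_m = (g@_m)%:MP.
Proof. by rewrite coefwiseE mcoeff_map_mpoly. Qed.
Lemma coefwiseC c : coefwise c%:MP = c%:MP%:MP.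
Proof. by rewrite coefwiseE map_mpolyC. Qed.

Lemma swap_frac_coefwise g : swap_frac (coefwise g) = (tofrac g)%:MP.
Proof.
elim/mpoly_ind_var: g => [c|p q IHp IHq|l p IH].
- by rewrite coefwiseC swap_fracC map_mpolyC.
- by rewrite tofracD mpolyCD coefwiseD swap_fracD IHp IHq.
- by rewrite tofracM mpolyCM coefwiseM coefwiseX swap_fracM swap_fracX IH.
Qed.

Lemma mcoeff_swap_frac f al : (swap_frac f)@_al = tofrac (map_mpoly (mcoeff al) f).
Proof.
elim/mpolyind: f => [|c m p _ _ IH]; first by rewrite !raddf0 ?mcoeff0.
have mapD g h : map_mpoly (mcoeff al) (g + h) =
    map_mpoly (mcoeff al) g + map_mpoly (mcoeff al) h by exact: raddfD.
rewrite mapD tofracD swap_fracD mcoeffD IH; congr (_ + _).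
rewrite -mul_mpolyC swap_fracM swap_fracC swap_fracX mulrC mcoeffCM mcoeff_map_mpoly.
rewrite /const_frac -rmorphM mulrC mul_mpolyC; congr tofrac; apply/mpolyP => l.
rewrite mcoeff_map_mpoly mcoeffCM mcoeffZ !mcoeffX.
by case: eqP => _; rewrite /= ?mulr1n ?mulr0n ?mulr1 ?mulr0 ?mcoeff0.
Qed.

Lemma swap_frac_inj : injective swap_frac.
Proof.
move=> f g fg; apply/mpolyP => m; apply/mpolyP => al.
have := congr1 (mcoeff al) fg; rewrite !mcoeff_swap_frac => /eqP; rewrite tofrac_eq => /eqP.
by move=> /(congr1 (mcoeff m)); rewrite !mcoeff_map_mpoly.
Qed.

Lemma swap_frac_clear q : exists2 D : R, D != 0 &
  exists f, (tofrac D)%:MP * q = swap_frac f.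
Proof.
elim/mpoly_ind_var: q => [x|p q [D1 D10 [f1 E1]] [D2 D20 [f2 E2]]|l p [D D0 [f E]]].
- exists (frac (repr x)).2; [exact: denom_ratioP|exists (coefwise (frac (repr x)).1)].
  by rewrite swap_frac_coefwise -mpolyCM fraction_repr.
- exists (D1 * D2); first by rewrite mulf_neq0.
  exists (coefwise D2 * f1 + coefwise D1 * f2).
  rewrite tofracM mpolyCM swap_fracD !swap_fracM !swap_frac_coefwise -E1 -E2.
  by move: (tofrac D1)%:MP (tofrac D2)%:MP => *; ring.
- exists D => //; exists (('X_l)%:MP * f).
  by rewrite swap_fracM swap_fracC map_mpolyX -E mulrCA.
Qed.

Lemma swap_frac_homog i q f D : q \is i.-homog -> (tofrac D)%:MP * q = swap_frac f ->
  forall m, f@_m \is i.-homog.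
Proof.
move=> qi E m; apply/dhomogP => al; rewrite mcoeff_msupp; apply: contraNeq => ali.
have := mcoeff_swap_frac f al; rewrite -E mcoeffCM (dhomog_nemf_coeff qi ali) mulr0.
move/esym/eqP; rewrite tofrac_eq0 => /eqP/(congr1 (mcoeff m)).
by rewrite mcoeff_map_mpoly mcoeff0 => /eqP.
Qed.

End FractionCoefficients.

Section RationalExtension.
Variables (V : finType) (D : {set {set V}}) (k : fieldType) (d N : nat) (a : 'I_d -> V -> k).

Local Notation P := {mpoly k[#|V|]}.
Local Notation R := {mpoly k[N]}.
Local Notation K := {fraction R}.
Local Notation tofrac := (@FracField.tofrac R).
Local Notation aK := (fun i u => const_frac N (a i u)).
Local Notation J := (red_ideal D a).
Local Notation JK := (red_ideal D aK).

(** The coefficients of [g] are scalars, and a nonzero scalar in J would make J the unit ideal. *)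
Lemma lead_mod_coefwise (g : R) : 1 \notin J -> g != 0 ->
  lead_mod (red_gen D a) (coefwise #|V| g) (mlead g) /\ g@_(mlead g) != 0.
Proof.
move=> J1 g0; have gl : g@_(mlead g) != 0 by rewrite mleadc_eq0.
split=> //; split=> [|m gm]; rewrite mcoeff_coefwise.
  apply: contra J1 => gJ; have := in_idealMr ((g@_(mlead g))^-1)%:MP gJ.
  by rewrite -mpolyCM mulVf ?mpolyC1.
by rewrite (mcoeff_gt_mlead gm) mpolyC0 rpred0.
Qed.

Lemma mpolyC_coef_ideal (e : k) p : e != 0 -> (e%:MP * p \in J) = (p \in J).
Proof.
move=> e0; apply/idP/idP => [epJ|]; last exact: in_idealMr.
by rewrite -[p]mul1r -(mpolyC1 _ k) -(mulVf e0) mpolyCM -mulrA; apply: in_idealMr.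
Qed.

Lemma unit_ideal p : 1 \in J -> p \in J.
Proof. by move=> J1; rewrite -[p]mulr1; apply: in_idealMr. Qed.

Lemma red_ideal_clear q : q \in JK -> exists2 g : R, g != 0 &
  exists2 f, (tofrac g)%:MP * q = swap_frac f & forall m, f@_m \in J.
Proof.
move: q; apply: in_ideal_ind => [|p q [g1 g10 [f1 E1 f1J]] [g2 g20 [f2 E2 f2J]]|q h].
- exists 1; first exact: oner_neq0.
  by exists 0 => [|m]; rewrite ?mulr0 ?raddf0 ?rpred0.
- exists (g1 * g2); first by rewrite mulf_neq0.
  exists (coefwise #|V| g2 * f1 + coefwise #|V| g1 * f2).
    rewrite tofracM mpolyCM swap_fracD !swap_fracM !swap_frac_coefwise -E1 -E2.
    by move: (tofrac g1)%:MP (tofrac g2)%:MP => *; ring.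
  move=> m; rewrite mcoeffD !mcoeffM; apply: rpredD; apply: rpred_sum => -[l1 l2] _ /=.
    exact/in_idealMr/f1J.
  exact/in_idealMr/f2J.
- move=> /map_red_gen[h' h'J ->]; have [g g0 [f E]] := swap_frac_clear q.
  exists g => //; exists (f * h'%:MP); first by rewrite swap_fracM swap_fracC mulrA E.
  by move=> m; rewrite mulrC mcoeffCM; apply/in_idealMl/in_ideal_gen.
Qed.

(** Membership over k(c) is coefficientwise membership over k. After clearing a denominator g, a
    leading coefficient of [f] outside J would remain outside it when multiplied by the leading
    scalar of g. *)
Lemma swap_frac_ideal f : swap_frac f \in JK <-> forall m, f@_m \in J.
Proof.
split=> [/red_ideal_clear[g g0 [f' E f'J]] m|fJ]; last first.
  rewrite (mpolyE f) (raddf_sum (@swap_frac _ _ _)); apply: rpred_sum => m _ /=.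
  rewrite -mul_mpolyC swap_fracM swap_fracC; apply/in_idealMl.
  exact: (@red_ideal_map _ _ (@const_frac N k)) (fJ m).
have [J1|J1] := boolP (1 \in J); first exact: unit_ideal.
apply: contrapT => /negP fm; have [l fl] := lead_mod_exists fm.
have [gl gl0] := lead_mod_coefwise J1 g0.
have [] : lead_mod (red_gen D a) f' (mlead g + l).
  have -> : f' = coefwise #|V| g * f.
    by apply: swap_frac_inj; rewrite swap_fracM swap_frac_coefwise.
  apply: lead_modM => //; rewrite mcoeff_coefwise mpolyC_coef_ideal //.
  by case: fl.
by rewrite f'J.
Qed.

Lemma frac_clear_ideal (g : R) q : g != 0 -> (tofrac g)%:MP * q \in JK -> q \in JK.
Proof.
move=> g0 gq; have gF : tofrac g != 0 by rewrite tofrac_eq0.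
by rewrite -[q]mul1r -(mpolyC1 _ K) -(mulVf gF) mpolyCM -mulrA; apply: in_idealMr.
Qed.

(** If the cleared [q] had a leading coefficient outside J, that coefficient would be a form of
    degree i over k, and by anisotropy its square would be a leading coefficient of the square of
    the cleared [q] outside J. *)
Lemma anisotropic_extension i :
  (forall p : P, p \is i.-homog -> p ^+ 2 \in J -> p \in J) ->
  forall q : {mpoly K[#|V|]}, q \is i.-homog -> q ^+ 2 \in JK -> q \in JK.
Proof.
move=> an q qi q2; have [g g0 [f E]] := swap_frac_clear q.
have fi := swap_frac_homog qi E.
apply: (frac_clear_ideal g0); rewrite E; apply/swap_frac_ideal => m.
apply: contrapT => /negP /lead_mod_exists[l fl].
have f2J : forall m, (f * f)@_m \in J.
  apply/swap_frac_ideal; rewrite swap_fracM -E.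
  by apply: in_ideal_eq (in_idealMr ((tofrac g)%:MP ^+ 2) q2) _; rewrite -exprMn expr2.
have sq : f@_l * f@_l \notin J by rewrite -expr2; apply: contra (an _ (fi l)) (proj1 fl).
by have [] := lead_modM fl fl sq; rewrite f2J.
Qed.

(* The leading exponents of [f^2 * C] and of [r^2 * z] have different parities
   as soon as the monomial C has an odd exponent. *)
Lemma anisotropic_extension_odd i (z : P) (C : 'X_{1..N}) (l0 : 'I_N) (e : k) :
  (forall p : P, p \is i.-homog -> p ^+ 2 \in J -> p \in J) ->
  odd (C l0) -> z \notin J -> e != 0 ->
  forall (q : {mpoly K[#|V|]}) (r : K), q \is i.-homog ->
  (tofrac 'X_[C])%:MP * q ^+ 2 + (const_frac N e * r ^+ 2) *: map_mpoly (@const_frac N k) z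
    \in JK ->
  q \in JK /\ r = 0.
Proof.
move=> an Codd zJ e0 q r qi.
have J1 : 1 \notin J by apply: contra zJ; apply: unit_ideal.
have [g1 g10 [f1 E1]] := swap_frac_clear q.
have g20 := denom_ratioP (repr r); have E2 := fraction_repr r.
move: (frac (repr r)).2 g20 (frac (repr r)).1 E2 => g2 g20 h E2.
(* A common denominator of [q] and [r]: the relation becomes C f^2 + e y^2 z with f and y free of
   denominators. *)
move=> qrJ; pose g := g1 * g2; have g0 : g != 0 by rewrite mulf_neq0.
pose f := coefwise #|V| g2 * f1; pose y := g1 * h.
have E : (tofrac g)%:MP * q = swap_frac f.
  rewrite swap_fracM swap_frac_coefwise -E1 /g tofracM mpolyCM.
  by rewrite mulrCA mulrA.
have Er : tofrac g * r = tofrac y by rewrite /g /y !tofracM -E2 mulrA.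
have fi := swap_frac_homog qi E.
clearbody f y g.
have mapM : map_mpoly (@const_frac N k) (e%:MP * z) =
    (const_frac N e)%:MP * map_mpoly (@const_frac N k) z.
  by rewrite rmorphM /= map_mpolyC.
have sumJ m : ('X_[C] * (f * f) + coefwise #|V| (y * y) * (e%:MP * z)%:MP)@_m \in J.
  move: m; apply/swap_frac_ideal.
  rewrite swap_fracD !swap_fracM swap_fracX swap_frac_coefwise tofracM -E -Er swap_fracC mapM.
  apply: in_ideal_eq (in_idealMr ((tofrac g)%:MP ^+ 2) qrJ) _.
  rewrite -mul_mpolyC [r ^+ 2]expr2 !mpolyCM.
  ring.
have lead_f l : lead_mod (red_gen D a) f l ->
    lead_mod (red_gen D a) ('X_[C] * (f * f)) (C + (l + l)).
  move=> fl; have sq : f@_l * f@_l \notin J.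
    by rewrite -expr2; apply: contra (an _ (fi l)) (proj1 fl).
  apply: lead_modM; [exact: lead_modX|exact: lead_modM|].
  rewrite mcoeffX eqxx mul1r; exact: (proj1 (lead_modM fl fl sq)).
have lead_y : y != 0 -> lead_mod (red_gen D a)
    (coefwise #|V| (y * y) * (e%:MP * z)%:MP) (mlead y + mlead y + 0).
  move=> y0; rewrite -(mleadM y0 y0).
  have [yl yl0] := lead_mod_coefwise J1 (mulf_neq0 y0 y0).
  apply: lead_modM => //.
    by apply: lead_mod_const; rewrite mpolyC_coef_ideal.
  by rewrite mcoeffC eqxx mulr1 mcoeff_coefwise !mpolyC_coef_ideal.
have fJ m : f@_m \in J.
  apply: contrapT => /negP /lead_mod_exists[l /lead_f fl].
  have [y0|y0] := eqVneq y 0.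
    case: fl => /negP + _; apply; have := sumJ (C + (l + l))%MM.
    by rewrite y0 mul0r coefwiseE raddf0 mul0r addr0.
  have /mnmP/(_ l0) := lead_modD fl (lead_y y0) sumJ.
  rewrite !mnmDE mnm0E addn0 => /(congr1 odd).
  by rewrite !oddD Codd !addbb.
split; first by apply: (frac_clear_ideal g0); rewrite E; apply/swap_frac_ideal.
have [y0|y0] := eqVneq y 0.
  by move/eqP: Er; rewrite y0 tofrac0 mulf_eq0 tofrac_eq0 (negPf g0) => /eqP.
(* All coefficients of f lie in J, so the term in y^2 lies in J by itself, against its leading
   coefficient, a nonzero scalar times z. *)
case: (lead_y y0) => /negP + _; case.
set M := (_ + _ + _)%MM; have := sumJ M; rewrite mcoeffD rpredDl //.
rewrite mcoeffM; apply: rpred_sum => -[l1 l2] _ /=; apply/in_idealMr.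
by rewrite mcoeffM; apply: rpred_sum => -[l3 l4] _ /=; apply/in_idealMr.
Qed.

End RationalExtension.

(** * The fundamental cycle of a homology sphere *)

Section Chains.
Variables (F : fieldType) (V : finType).
Implicit Types (D L : {set {set V}}) (t r s : {set V}) (c z : chain F V).

Definition chain_coef c t : F := (c : {ffun {set V} -> F^o}) t.

Lemma chain_coefD c c' t : chain_coef (c + c') t = chain_coef c t + chain_coef c' t.
Proof. by rewrite /chain_coef ffunE. Qed.
Lemma chain_coefB c c' t : chain_coef (c - c') t = chain_coef c t - chain_coef c' t.
Proof. by rewrite /chain_coef !ffunE. Qed.
Lemma chain_coefZ e c t : chain_coef (e *: c) t = e * chain_coef c t.
Proof. by rewrite /chain_coef ffunE. Qed.
Lemma chain_coef0 t : chain_coef 0 t = 0.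
Proof. by rewrite /chain_coef ffunE. Qed.
Lemma chain_coef_sum (I : Type) (q : seq I) (P : pred I) (E : I -> chain F V) t :
  chain_coef (\sum_(i <- q | P i) E i) t = \sum_(i <- q | P i) chain_coef (E i) t.
Proof.
by apply: (big_morph (chain_coef^~ t)) => [c c'|]; [exact: chain_coefD|exact: chain_coef0].
Qed.
Lemma chain_coef_simplex t u : chain_coef (simplex F t) u = (u == t)%:R.
Proof. by rewrite /chain_coef ffunE. Qed.

Lemma chainP c c' : chain_coef c =1 chain_coef c' -> c = c'.
Proof. by move=> e; apply/ffunP => t; apply: e. Qed.

Lemma simplex_neq0 t : simplex F t != 0.
Proof.
apply/eqP => /(congr1 (chain_coef^~ t)); rewrite chain_coef_simplex eqxx chain_coef0 => /eqP.
by rewrite oner_eq0.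
Qed.

Lemma chain_simplices c : c = \sum_t chain_coef c t *: simplex F t.
Proof.
apply: chainP => u; rewrite chain_coef_sum (bigD1 u) //= chain_coefZ chain_coef_simplex eqxx mulr1.
by rewrite big1 ?addr0 // => t tu; rewrite chain_coefZ chain_coef_simplex eq_sym (negPf tu) mulr0.
Qed.

Lemma mem_chains D k c :
  reflect (forall t, chain_coef c t != 0 -> t \in D /\ #|t| = k) (c \in chains F D k).
Proof.
apply: (iffP idP) => [/coord_span -> t|cD].
  apply: contraNP => tD; rewrite chain_coef_sum big1 // => i _.
  have iD : (i < size (enum [set u in D | #|u| == k]))%N by rewrite -cardE.
  rewrite chain_coefZ (nth_map set0) // chain_coef_simplex.
  have := mem_nth set0 iD; rewrite mem_enum inE => /andP[uD /eqP uk].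
  by case: eqP => [tu|_]; [case: tD; rewrite tu|rewrite mulr0].
rewrite [c]chain_simplices; apply: memv_suml => t _.
have [->|c0] := eqVneq (chain_coef c t) 0; first by rewrite scale0r mem0v.
have [tD tk] := cD t c0; apply/memvZ/memv_span/map_f.
by rewrite mem_enum inE tD tk eqxx.
Qed.

Lemma chains_eq0 D k : (forall t, t \in D -> #|t| != k) -> chains F D k = 0%VS.
Proof.
move=> Dk; apply/eqP; rewrite -subv0; apply/subvP => c /mem_chains cD.
rewrite memv0; apply/eqP/chainP => t; rewrite chain_coef0; apply/eqP.
by apply: contraT => /cD[/Dk /eqP].
Qed.

Lemma simplex_chains D t : t \in D -> simplex F t \in chains F D #|t|.
Proof.
move=> tD; apply/mem_chains => u; rewrite chain_coef_simplex.
by case: (u =P t) => [->|_]; rewrite ?eqxx.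
Qed.

Lemma bdry_sum c : bdry F V c = \sum_t chain_coef c t *: simplex_bdry F t.
Proof. by rewrite lfunE. Qed.

Lemma chain_coef_bdry c r :
  chain_coef (bdry F V c) r =
  \sum_(w | w \notin r) chain_coef c (w |: r) * (-1) ^+ position (w |: r) w.
Proof.
rewrite bdry_sum chain_coef_sum.
rewrite (eq_bigr (fun t => \sum_(w in t)
  chain_coef c t * (-1) ^+ position t w * (r == t :\ w)%:R)); last first.
  move=> t _; rewrite chain_coefZ chain_coef_sum mulr_sumr; apply: eq_bigr => w _.
  by rewrite chain_coefZ chain_coef_simplex mulrA.
rewrite (exchange_big_dep predT) //= (bigID (mem r)) /= big1 ?add0r => [|w wr]; last first.
  apply: big1 => t wt; case: eqP => [rE|_]; last by rewrite mulr0.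
  by move: wr; rewrite rE !inE eqxx.
apply: eq_bigr => w wr; rewrite (bigD1 (w |: r)) ?setU11 //= setU1K // eqxx mulr1.
rewrite big1 ?addr0 // => t /andP[wt twr]; case: eqP => [rE|_]; last by rewrite mulr0.
by move: twr; rewrite rE setD1K // eqxx.
Qed.

Lemma position_set1 (w : V) : position [set w] w = 0%N.
Proof.
apply/eqP; rewrite cards_eq0 -subset0; apply/subsetP => u.
by rewrite !inE => /andP[/eqP ->]; rewrite ltnn.
Qed.

Lemma bdry_vertex (w : V) : bdry F V (simplex F [set w]) = simplex F set0.
Proof.
rewrite bdry_simplex /simplex_bdry big_set1 position_set1 expr0 scale1r.
by congr simplex; apply/setP => u; rewrite !inE andNb.
Qed.

Lemma bdry_chains D k c : simplicial_complex D ->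
  c \in chains F D k.+1 -> bdry F V c \in chains F D k.
Proof.
move=> [_ Dsub] /mem_chains cD; rewrite bdry_sum; apply: memv_suml => t _.
have [->|/cD[tD tk]] := eqVneq (chain_coef c t) 0; first by rewrite scale0r mem0v.
apply: memvZ; apply: memv_suml => w wt; apply: memvZ.
have -> : k = #|t :\ w| by move: tk; rewrite (cardsD1 w) wt => -[].
by apply/simplex_chains/(Dsub t) => //; apply: subsetDl.
Qed.

Lemma link_complex D s : simplicial_complex D -> s \in D -> simplicial_complex (link D s).
Proof.
move=> [D0 Dsub] sD; split=> [|t u]; first by rewrite !inE set0U set0I eqxx D0 sD.
rewrite !inE => /and3P[tD tsD ts] ut; apply/and3P; split; first exact: Dsub ut.
  by apply: Dsub tsD _; apply: setSU.
by rewrite -subset0 -(eqP ts); apply: setSI.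
Qed.

Lemma vertex_link D s w : simplicial_complex D -> w \notin s ->
  ([set w] \in link D s) = (w |: s \in D).
Proof.
move=> [_ Dsub] ws; rewrite !inE; apply/and3P/idP => [[_ //]|wsD]; split=> //.
  by apply: Dsub wsD _; apply: subsetUl.
by apply/eqP/setP => u; rewrite !inE; case: eqP => // ->; rewrite (negPf ws).
Qed.

End Chains.

Section TopCycle.
Variables (F : fieldType) (V : finType) (D : {set {set V}}) (d : nat).
Hypothesis Dsphere : homology_sphere F (d%:Z - 1) D.

Let Dcomplex : simplicial_complex D := proj1 Dsphere.

(** The link of a facet is the complex of the empty face, whose homology in shifted degree 0 is
    nonzero; only a (-1)-sphere allows this. *)
Lemma sphere_facet_card s : facet D s -> #|s| = d.
Proof.
move=> sF; have sD := maxsetp sF.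
have L0 t : t \in link D s -> t = set0.
  rewrite !inE => /and3P[_ tsD /eqP ts].
  have /setUidPr tsub := maxsetsup sF tsD (subsetUr _ _).
  by rewrite -ts; apply/esym/setIidPl.
have := (proj2 Dsphere s sD) 0%N.
have : (0 < homology_dim F (link D s) 0)%N.
  rewrite /homology_dim /boundaries (chains_eq0 F (k := 1)); last first.
    by move=> t /L0 ->; rewrite cards0.
  rewrite limg0 dimv0 subn0 lt0n dimv_eq0; apply/eqP => cyc0.
  have : simplex F (set0 : {set V}) \in cycles F (link D s) 0.
    rewrite memv_cap memv_ker bdry_simplex /simplex_bdry big_set0 eqxx andbT.
    rewrite -[0%N](cards0 V); apply: simplex_chains.
    exact: (proj1 (link_complex Dcomplex sD)).
  by rewrite cyc0 memv0 (negPf (simplex_neq0 _ _)).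
case: (homology_dim _ _ _) => // h _ /esym/eqP; case: eqP => // /eqP.
lia.
Qed.

Lemma sphere_face_facet r : r \in D -> exists2 t, t \in D & r \subset t /\ #|t| = d.
Proof.
move=> rD; have [t tmax rt] := maxset_exists (P := fun t => t \in D) rD.
by exists t; rewrite ?(maxsetp tmax) // (sphere_facet_card tmax).
Qed.

Lemma sphere_card_le r : r \in D -> (#|r| <= d)%N.
Proof. by move=> /sphere_face_facet[t _ [/subset_leq_card rt <-]]. Qed.

Lemma sphere_top_cycle : exists2 z, z \in cycles F D d & z != 0.
Proof.
have := proj2 Dsphere set0 (proj1 Dcomplex) d.
have -> : link D set0 = D.
  by apply/setP => t; rewrite !inE setU0 setI0 eqxx andbT andbb.
rewrite cards0 subr0 eqxx /homology_dim => dim1.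
exists (vpick (cycles F D d)); first exact: memv_pick.
by rewrite vpick0 -dimv_eq0; apply: contra_eqN dim1 => /eqP ->.
Qed.

Section Links.
Variable r : {set V}.
Hypothesis rD : r \in D.
Local Notation L := (link D r).

Lemma vertex_chain u : u \notin r -> u |: r \in D -> simplex F [set u] \in chains F L 1.
Proof.
move=> ur urD; have uL : [set u] \in L by rewrite vertex_link.
by have := simplex_chains F uL; rewrite cards1.
Qed.

Lemma vertex_diff_cycle u w : u \notin r -> w \notin r -> u |: r \in D -> w |: r \in D ->
  simplex F [set u] - simplex F [set w] \in cycles F L 1.
Proof.
move=> ur wr urD wrD; rewrite memv_cap memv_ker linearB /= !bdry_vertex subrr eqxx andbT.
by apply: rpredB; apply: vertex_chain.
Qed.

(** The link of a ridge is a set of points with a one-dimensional space of cycles. The cycle [z]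
    induces a cycle y there; if nonzero, y spans that space, so the difference of the points w and u
    is a multiple of y, and y cannot vanish at u. *)
Lemma ridge_cycle z u w : #|r|.+1 = d -> z \in cycles F D d ->
  u \notin r -> w \notin r -> u |: r \in D -> w |: r \in D ->
  chain_coef z (u |: r) = 0 -> chain_coef z (w |: r) = 0.
Proof.
move=> rd zcyc ur wr urD wrD zu; have [->|uw] := eqVneq w u; first exact: zu.
have := proj2 Dsphere r rD 1%N.
rewrite /homology_dim /boundaries (chains_eq0 F (k := 2)); last first.
  move=> t; rewrite !inE => /and3P[_ /sphere_card_le tr /eqP tr0].
  move: tr; rewrite cardsU tr0 cards0 subn0 -rd; case: eqP => // ->; lia.
rewrite limg0 dimv0 subn0.
have -> : 1%N%:Z - 1 == d%:Z - 1 - #|r|%:Z by apply/eqP; lia.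
move=> dim1.
pose e v := (-1) ^+ position (v |: r) v * chain_coef z (v |: r).
pose y := \sum_(v | (v \notin r) && (v |: r \in D)) e v *: simplex F [set v].
have ye v : v \notin r -> v |: r \in D -> chain_coef y [set v] = e v.
  move=> vr vrD; rewrite chain_coef_sum (bigD1 v) ?vr //= chain_coefZ chain_coef_simplex eqxx mulr1.
  rewrite big1 ?addr0 // => v' /andP[_ v'v]; rewrite chain_coefZ chain_coef_simplex.
  by rewrite (inj_eq set1_inj) eq_sym (negPf v'v) mulr0.
move: zcyc; rewrite memv_cap memv_ker => /andP[/mem_chains zD /eqP z0].
have ycyc : y \in cycles F L 1.
  rewrite memv_cap memv_ker; apply/andP; split.
    apply: rpred_sum => v /andP[vr vrD]; apply: rpredZ.
    exact: vertex_chain.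
  rewrite linear_sum /=; under eq_bigr do rewrite linearZ /= bdry_vertex.
  rewrite -scaler_suml; apply/eqP; rewrite (_ : \sum_(_ | _) _ = 0) ?scale0r //.
  have : chain_coef (bdry F V z) r = 0 by rewrite z0 chain_coef0.
  rewrite chain_coef_bdry (bigID (fun v => v |: r \in D)) /= [X in _ + X]big1 ?addr0; last first.
    move=> v /andP[_ vrD]; suff -> : chain_coef z (v |: r) = 0 by rewrite mul0r.
    by apply: contraNeq vrD => /zD[].
  by move=> H; rewrite -[RHS]H; apply: eq_bigr => v _; rewrite mulrC.
have [y0|y0] := eqVneq y 0.
  have := ye w wr wrD; rewrite y0 chain_coef0 /e => /esym/eqP.
  by rewrite mulf_eq0 signr_eq0 => /eqP.
have yline : <[y]>%VS = cycles F L 1.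
  by apply/eqP; rewrite eqEdim dim_vline y0 dim1 -memvE ycyc.
have := vertex_diff_cycle wr ur wrD urD.
rewrite -yline => /vlineP[l E].
have := congr1 (fun c : chain F V => chain_coef c [set u]) E.
rewrite chain_coefB chain_coefZ !chain_coef_simplex eqxx (inj_eq set1_inj) eq_sym (negPf uw).
rewrite ye // /e zu.
by rewrite mulr0 mulr0 sub0r => /eqP; rewrite oppr_eq0 oner_eq0.
Qed.

(** Vanishing reduced homology of the link in dimension 0 means that the link is connected; in
    cochain form, a function constant along edges is constant on vertices. *)
Lemma link_connected (chi : V -> F) : (#|r|.+1 < d)%N ->
  (forall u w, u \notin r -> w \notin r -> u |: (w |: r) \in D -> chi u = chi w) ->
  forall u w, u \notin r -> w \notin r -> u |: r \in D -> w |: r \in D -> chi u = chi w.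
Proof.
move=> rd chi_edge u w ur wr urD wrD.
have sub : (boundaries F L 1 <= cycles F L 1)%VS.
  apply/subvP => _ /memv_imgP[c cL ->]; rewrite memv_cap memv_ker bdry_bdry eqxx andbT.
  exact: bdry_chains (link_complex Dcomplex rD) cL.
have := proj2 Dsphere r rD 1%N; rewrite /homology_dim.
have -> : (1%N%:Z - 1 == d%:Z - 1 - #|r|%:Z) = false by apply/eqP; lia.
(* [homology_dim] is a truncated difference, so its vanishing only bounds the cycles; with [sub] the
   two spaces coincide. *)
move=> /eqP; rewrite subn_eq0 => dimle.
have := vertex_diff_cycle ur wr urD wrD.
have /eqP <- : boundaries F L 1 == cycles F L 1 by rewrite eqEdim sub.
move=> /memv_imgP[c /mem_chains cL E].
(* The 0-cochain with values chi. It kills boundaries: chi is constant on each edge, and the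
   coefficients of the boundary of an edge sum to zero. *)
pose phi c' := \sum_v chi v * chain_coef c' [set v].
have phi_simplex v : phi (simplex F [set v]) = chi v.
  rewrite /phi (bigD1 v) //= chain_coef_simplex eqxx mulr1 big1 ?addr0 // => v' v'v.
  by rewrite chain_coef_simplex (inj_eq set1_inj) (negPf v'v) mulr0.
have : phi (simplex F [set u] - simplex F [set w]) = 0.
  rewrite E bdry_sum /phi.
  rewrite (eq_bigr (fun v => \sum_t
    chi v * (chain_coef c t * chain_coef (simplex_bdry F t) [set v]))); last first.
    by move=> v _; rewrite chain_coef_sum mulr_sumr; apply: eq_bigr => t _; rewrite chain_coefZ.
  rewrite exchange_big big1 // => t _.
  have [->|/cL[tL t2]] := eqVneq (chain_coef c t) 0.
    by rewrite big1 // => v _; rewrite mul0r mulr0.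
  have supp v : chain_coef (simplex_bdry F t) [set v] != 0 -> v \in t.
    apply: contraR => vt; rewrite chain_coef_sum big1 // => v' v't.
    rewrite chain_coefZ chain_coef_simplex; case: eqP => [vE|_]; last by rewrite mulr0.
    by move: vt; have := set11 v; rewrite vE inE => /andP[_ ->].
  have /card_gt0P[x xt] : (0 < #|t|)%N by rewrite t2.
  have chit v : v \in t -> chi v = chi x.
    move: tL; rewrite !inE => /and3P[_ trD /eqP tr0] vt.
    have out v' : v' \in t -> v' \notin r.
      by move=> v't; apply/negP => v'r; have := in_set0 v'; rewrite -tr0 inE v't v'r.
    apply: chi_edge; rewrite ?out //; apply: (proj2 Dcomplex) trD _.
    apply/subsetP => v'; rewrite !inE => /or3P[/eqP ->|/eqP ->|->]; rewrite ?vt ?xt ?orbT //.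
  (* At the empty face, the coefficient of the double boundary is the sum of the coefficients of the
     boundary of t. *)
  have : chain_coef (bdry F V (simplex_bdry F t)) set0 = 0.
    by rewrite -bdry_simplex bdry_bdry chain_coef0.
  rewrite chain_coef_bdry => bt.
  rewrite (eq_bigr (fun v =>
    chi x * chain_coef c t * chain_coef (simplex_bdry F t) [set v])); last first.
    move=> v _; have [->|/supp/chit ->] := eqVneq (chain_coef (simplex_bdry F t) [set v]) 0.
      by rewrite !mulr0.
    by rewrite mulrA.
  rewrite -mulr_sumr -[RHS](mulr0 (chi x * chain_coef c t)) -[in RHS]bt; congr (_ * _).
  by apply: eq_big => [v|v _]; rewrite ?inE // setU0 position_set1 mulr1.
have phiB c1 c2 : phi (c1 - c2) = phi c1 - phi c2.
  by rewrite /phi -sumrB; apply: eq_bigr => v _; rewrite chain_coefB mulrBr.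
by rewrite phiB !phi_simplex => /eqP; rewrite subr_eq0 => /eqP.
Qed.

End Links.

(** Strong connectedness, by induction on the codimension of r: around r the support of [z] is all
    the facets or none. [ridge_cycle] settles ridges; for smaller r, the claim for [v |: r] is
    carried from one vertex v of the link to another by [link_connected]. *)
Lemma sphere_cycle_support z : z \in cycles F D d -> forall r, r \in D ->
  forall t t', t \in D -> t' \in D -> #|t| = d -> #|t'| = d -> r \subset t -> r \subset t' ->
  chain_coef z t != 0 -> chain_coef z t' != 0.
Proof.
move=> zcyc r; have [n] := ubnP (d - #|r|).
elim: n r => // n IH r rn rD t t' tD t'D td t'd rt rt' zt.
have [rd|rd] := eqVneq #|r| d.
  have <- : r = t' by apply/eqP; rewrite eqEcard rt' t'd rd leqnn.
  suff -> : r = t by []. by apply/eqP; rewrite eqEcard rt td rd leqnn.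
have {}rd : (#|r| < d)%N by rewrite ltn_neqAle rd -td subset_leq_card.
have pick (s : {set V}) : r \subset s -> #|s| = d -> exists2 u, u \notin r & u |: r \subset s.
  move=> rs sd; have /subsetPn[u us ur] : ~~ (s \subset r).
    by apply/negP => /subset_leq_card; rewrite sd leqNgt rd.
  by exists u => //; rewrite subUset sub1set us.
have [u ur ut] := pick t rt td; have [u' u'r u't'] := pick t' rt' t'd.
have uD : u |: r \in D := proj2 Dcomplex _ _ tD ut.
have u'D : u' |: r \in D := proj2 Dcomplex _ _ t'D u't'.
have IHu v : v \notin r -> v |: r \in D -> forall t t', t \in D -> t' \in D ->
    #|t| = d -> #|t'| = d -> v |: r \subset t -> v |: r \subset t' ->
    chain_coef z t != 0 -> chain_coef z t' != 0.
  by move=> vr vD; apply: IH => //; rewrite cardsU1 vr add1n subnS prednK ?subn_gt0.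
have [ridge|notridge] := eqVneq #|r|.+1 d.
  have full v (s : {set V}) : v \notin r -> #|s| = d -> v |: r \subset s -> s = v |: r.
    by move=> vr sd vs; apply/esym/eqP; rewrite eqEcard vs cardsU1 vr sd -ridge leqnn.
  rewrite (full u' t') //; rewrite (full u t) // in zt.
  by apply: contra_neq zt; apply: ridge_cycle.
(* Indicates whether the support of [z] meets the star of [v |: r]. Adjacent vertices x and y agree
   because a facet through both lies in the stars of [x |: r] and [y |: r]. *)
pose chi v : F :=
  `[< exists t, [/\ t \in D, #|t| = d, v |: r \subset t & chain_coef z t != 0] >]%:R.
have chiE : chi u = chi u'.
  apply: (@link_connected r) => // [|x y xr yr xyD]; first by rewrite ltn_neqAle notridge.
  have [s sD [xys sd]] := sphere_face_facet xyD.
  have xs : x |: r \subset s by apply: subset_trans xys; rewrite setUCA subsetUr.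
  have ys : y |: r \subset s by apply: subset_trans xys; rewrite subsetUr.
  have down v : v |: r \subset s -> v |: r \in D by apply: (proj2 Dcomplex).
  rewrite /chi; congr (nat_of_bool _)%:R; apply: asbool_equiv_eq; split.
    move=> [t0 [t0D t0d xt0 zt0]]; exists s; split=> //.
    exact: (IHu x xr (down x xs) t0 s).
  move=> [t0 [t0D t0d xt0 zt0]]; exists s; split=> //.
  exact: (IHu y yr (down y ys) t0 s).
have : chi u = 1.
  by rewrite /chi; case: asboolP => // -[]; exists t.
rewrite chiE /chi; case: asboolP => [[t0 [t0D t0d ut0 zt0]] _|_ /esym/eqP]; last first.
  by rewrite oner_eq0.
exact: (IHu u' u'r u'D t0 t').
Qed.

Lemma sphere_fundamental_cycle : exists2 z, z \in cycles F D d &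
  forall t, t \in D -> #|t| = d -> chain_coef z t != 0.
Proof.
have [z zcyc z0] := sphere_top_cycle; exists z => // t tD td.
have [t0 zt0] : exists t0, chain_coef z t0 != 0.
  apply/not_existsP => H; move/eqP: z0; apply; apply: chainP => t0.
  by rewrite chain_coef0; apply/eqP; apply: contrapT => /negP /H.
have := zcyc; rewrite memv_cap => /andP[/mem_chains/(_ t0 zt0)[t0D t0d] _].
by apply: (sphere_cycle_support zcyc (proj1 Dcomplex) t0D tD); rewrite ?sub0set.
Qed.

End TopCycle.

(** * Lee's functional *)

Section LeeFunctional.
Variables (K : fieldType) (V : finType) (D : {set {set V}}) (d : nat).
Variables (a : 'I_d -> V -> K) (w : 'I_d -> K) (q : {set V} -> K) (y : {set V} -> V -> K).

Local Notation T := [set t in D | #|t| == d].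

Hypothesis Dcomplex : simplicial_complex D.
Hypothesis d_gt0 : (0 < d)%N.
Hypothesis y_coord : forall t i, t \in T -> \sum_(u in t) a i u * y t u = w i.
Hypothesis y_neq0 : forall t u, t \in T -> u \in t -> y t u != 0.
Hypothesis ridge_sum : forall r : {set V}, #|r|.+1 = d ->
  \sum_(u | (u \notin r) && (u |: r \in D)) q (u |: r) / y (u |: r) u = 0.
Hypothesis separate : forall (r : {set V}) j, r \in D -> (#|r|.+1 < d)%N -> j \in r ->
  exists l : 'I_d -> K, [/\ \sum_i l i * a i j = 1,
    forall u, u \in r -> u != j -> \sum_i l i * a i u = 0 & \sum_i l i * w i = 0].

Definition facet_coord (t : {set V}) u := if u \in t then y t u else 0.
Definition weight t := q t / \prod_(u in t) y t u.
Definition lee_monomial (s : seq V) := \sum_(t in T) weight t * \prod_(u <- s) facet_coord t u.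

Lemma facet_coord_theta t i : t \in T -> \sum_u a i u * facet_coord t u = w i.
Proof.
move=> tT; rewrite -(y_coord i tT) [RHS]big_mkcond; apply: eq_bigr => u _.
by rewrite /facet_coord; case: ifP; rewrite ?mulr0.
Qed.

Lemma lee_monomial_perm s s' : perm_eq s s' -> lee_monomial s = lee_monomial s'.
Proof. by move=> ss'; apply: eq_bigr => t _; rewrite (perm_big _ ss'). Qed.

Lemma lee_monomial_nonface s : [set u in s] \notin D -> lee_monomial s = 0.
Proof.
move=> sD; apply: big1 => t; rewrite inE => /andP[tD _].
have [/allP st|/allPn[u us /negPf ut]] := boolP (all (fun u => u \in t) s).
  case/negP: sD; apply: (proj2 Dcomplex) tD _.
  by apply/subsetP => u; rewrite inE => /st.
by rewrite (big_rem u us) /= /facet_coord ut mul0r mulr0.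
Qed.

(** Only facets [u |: r] contribute. The coordinates over r cancel against the weight, leaving the
    terms of [ridge_sum]. *)
Lemma lee_monomial_ridge s : uniq s -> (size s).+1 = d -> lee_monomial s = 0.
Proof.
move=> us sd; pose r := [set u in s].
have rd : #|r|.+1 = d by rewrite cardsE (card_uniqP us).
have prodE t : \prod_(u <- s) facet_coord t u = \prod_(u in r) facet_coord t u.
  by rewrite big_uniq //; apply: eq_bigl => u; rewrite inE.
clearbody r.
rewrite /lee_monomial (bigID (fun t : {set V} => r \subset t)) /=.
rewrite [X in _ + X]big1 ?addr0; last first.
  move=> t /andP[_ /subsetPn[u ur ut]].
  by rewrite prodE (bigD1 u) //= /facet_coord (negPf ut) mul0r mulr0.
rewrite -[RHS](ridge_sum rd).
rewrite (eq_bigl (fun t => t \in [set u |: r | u in [set u | (u \notin r) && (u |: r \in D)]])).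
  rewrite big_imset /=; last first.
    move=> u u'; rewrite !inE => /andP[ur _] /andP[u'r _] E.
    by have := setU11 u r; rewrite E !inE (negPf ur) orbF => /eqP.
  rewrite (eq_bigl (fun u => (u \notin r) && (u |: r \in D))); last by move=> u; rewrite inE.
  apply: eq_bigr => u /andP[ur urD].
  have urT : u |: r \in T by rewrite inE urD cardsU1 ur add1n rd eqxx.
  rewrite prodE /weight big_setU1 //= invfM mulrA -mulrA.
  have -> : \prod_(x in r) facet_coord (u |: r) x = \prod_(x in r) y (u |: r) x.
    by apply: eq_bigr => x xr; rewrite /facet_coord in_setU1 xr orbT.
  rewrite mulVf ?mulr1 //; apply/prodf_neq0 => x xr.
  by rewrite y_neq0 // in_setU1 xr orbT.
move=> t; apply/idP/imsetP => [|[u]]; rewrite !inE.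
  move=> /andP[/andP[tD /eqP td] rt].
  have /subsetPn[u ut ur] : ~~ (t \subset r).
    by apply/negP => /subset_leq_card; rewrite td -rd ltnn.
  have tE : t = u |: r.
    apply/esym/eqP; rewrite eqEcard subUset sub1set ut rt cardsU1 ur td -rd.
    by rewrite add1n leqnn.
  by exists u => //; rewrite inE ur -tE.
move=> /andP[ur urD] ->; rewrite urD subsetUr cardsU1 ur add1n rd eqxx //.
Qed.

Lemma lee_monomial_theta l s :
  \sum_u (\sum_i l i * a i u) * lee_monomial (u :: s) = (\sum_i l i * w i) * lee_monomial s.
Proof.
rewrite mulr_suml (eq_bigr (fun u => \sum_i (l i * a i u) * lee_monomial (u :: s))); last first.
  by move=> u _; rewrite mulr_suml.
rewrite exchange_big; apply: eq_bigr => i _ /=.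
rewrite /lee_monomial mulr_sumr (eq_bigr (fun u => \sum_(t in T) l i * (a i u * facet_coord t u) *
  (weight t * \prod_(x <- s) facet_coord t x))); last first.
  move=> u _; rewrite mulr_sumr; apply: eq_bigr => t _; rewrite big_cons; ring.
rewrite exchange_big; apply: eq_bigr => t tT /=.
by rewrite -mulr_suml -mulr_sumr facet_coord_theta.
Qed.

(* A repeated factor [j] is traded, through a linear form equal to 1 at [a_j]
   and to 0 at [w] and at the other vectors of the support, for new factors. *)
Lemma lee_monomial_eq0 s : (size s).+1 = d -> lee_monomial s = 0.
Proof.
(* Each trade keeps the degree and enlarges the support, until the monomial is squarefree or a
   nonface. *)
have [n] := ubnP (d - #|[set u in s]|); elim: n s => // n IH s sn sd.
have [us|nus] := boolP (uniq s); first exact: lee_monomial_ridge.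
have [sD|/lee_monomial_nonface //] := boolP ([set u in s] \in D).
have [j js] : exists j, (1 < count_mem j s)%N.
  apply/not_existsP => cnt; case/negP: nus; apply: count_mem_uniq => x.
  have /negP := cnt x; rewrite -leqNgt -has_pred1 has_count.
  by case: (count_mem x s) => [|[|]].
pose h := rem j s; have jin : j \in s by rewrite -has_pred1 has_count ltnW.
have sjh : perm_eq s (j :: h) by apply: perm_to_rem.
have jh : j \in h.
  by rewrite -has_pred1 has_count -ltnS -add1n; move: js; rewrite (permP sjh) /= eqxx.
have hs : [set u in s] = [set u in h].
  apply/setP => u; rewrite !inE (perm_mem sjh) inE.
  by case: eqP => // ->; rewrite jh.
rewrite (lee_monomial_perm sjh); move: sn sd sD; rewrite hs (perm_size sjh) /=.
set r := [set u in h].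
move=> rn hd rD; have rh : (#|r| <= size h)%N by rewrite cardsE card_size.
have rd : (#|r|.+1 < d)%N by rewrite -hd !ltnS.
have jr : j \in r by rewrite inE.
have [l [lj lr lw]] := separate rD rd jr.
have := lee_monomial_theta l h; rewrite lw mul0r (bigD1 j) //= lj mul1r big1 ?addr0 // => u uj.
have [ur|ur] := boolP (u \in r); first by rewrite lr // mul0r.
have ru : [set x in u :: h] = u |: r by apply/setP => x; rewrite !inE.
rewrite IH ?mulr0 //= ru cardsU1 ur add1n subnS prednK // subn_gt0.
exact: ltn_trans rd.
Qed.

Definition lee_functional p := \sum_(t in T) weight t * (line_eval (facet_coord t) p)`_d.

(** The induction moves the variables of [p] into the list [s]; at a constant, only lists of length
    d - 1 matter, and [lee_monomial_eq0] applies to them. *)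
Lemma lee_functional_pred p s : \sum_(t in T) weight t *
  (line_eval (facet_coord t) (\prod_(u <- s) var K u * p))`_d.-1 = 0.
Proof.
elim/mpoly_ind_vars: p s => [e|p p' IH IH'|u p IH] s.
- have line_s t : line_eval (facet_coord t) (\prod_(u <- s) var K u) =
      (\prod_(u <- s) facet_coord t u) *: 'X^(size s).
    elim: s => [|u s IHs].
      by rewrite !big_nil expr0 scale1r (rmorph1 (line_eval (facet_coord t))).
    rewrite !big_cons line_evalM line_evalX IHs -scalerAl -scalerAr scalerA.
    by rewrite exprS.
  rewrite (eq_bigr (fun t =>
    (weight t * \prod_(u <- s) facet_coord t u) * ((d.-1 == size s)%:R * e))).
    rewrite -mulr_suml; have [ds|_] := eqVneq d.-1 (size s); last by rewrite mul0r mulr0.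
    by have := @lee_monomial_eq0 s; rewrite /lee_monomial => -> //; rewrite ?mul0r // -ds prednK.
  move=> t _; rewrite line_evalM line_evalC line_s coefMC coefZ coefXn.
  by rewrite !mulrA.
- have lineD t (x : {mpoly K[#|V|]}) : weight t * (line_eval (facet_coord t) (x * (p + p')))`_d.-1 =
      weight t * (line_eval (facet_coord t) (x * p))`_d.-1 +
      weight t * (line_eval (facet_coord t) (x * p'))`_d.-1.
    by rewrite mulrDr line_evalD coefD mulrDr.
  by rewrite (eq_bigr _ (fun t _ => lineD t _)) big_split /= IH IH' addr0.
- rewrite -[RHS](IH (u :: s)); apply: eq_bigr => t _.
  by rewrite big_cons mulrCA mulrA.
Qed.

(** On the line attached to any facet, [theta a i] restricts to [w i] times X, independently of the
    facet. This lowers the degree to d - 1, where the functional vanishes. *)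
Lemma lee_functional_ideal p : p \in red_ideal D a -> lee_functional p = 0.
Proof.
move: p; apply: in_ideal_ind => [|p p' p0 p'0|g h [[A AD ->]|[i ->]]].
- by apply: big1 => t _; rewrite (rmorph0 (line_eval (facet_coord t))) coef0 mulr0.
- rewrite /lee_functional; rewrite (eq_bigr (fun t => weight t * (line_eval (facet_coord t) p)`_d +
    weight t * (line_eval (facet_coord t) p')`_d)) => [|t _]; last first.
    by rewrite line_evalD coefD mulrDr.
  by move: p0 p'0; rewrite big_split /= /lee_functional => -> ->; rewrite addr0.
- apply: big1 => t; rewrite inE => /andP[tD _].
  have /subsetPn[u uA ut] : ~~ (A \subset t).
    by apply: contra AD; apply: (proj2 Dcomplex).
  rewrite line_evalM line_eval_prod (bigD1 u) //= /facet_coord (negPf ut) mul0r scale0r mulr0.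
  by rewrite coef0 mulr0.
- have := lee_functional_pred g [::]; rewrite big_nil mul1r => g0.
  rewrite /lee_functional (eq_bigr (fun t => w i * (weight t *
    (line_eval (facet_coord t) g)`_d.-1))) => [|t tT]; first by rewrite -mulr_sumr g0 mulr0.
  have -> : line_eval (facet_coord t) (g * theta a i) = w i *: (line_eval (facet_coord t) g * 'X).
    rewrite line_evalM scalerAr; congr (_ * _).
    rewrite /theta (rmorph_sum (line_eval (facet_coord t))) /=.
    under eq_bigr do rewrite line_evalZ line_evalX scalerA.
    by rewrite -scaler_suml facet_coord_theta.
  by rewrite coefZ coefMX gtn_eqF // mulrCA.
Qed.

Lemma facet_notin_ideal s : s \in T -> q s != 0 -> \prod_(u in s) var K u \notin red_ideal D a.
Proof.
move=> sT; apply: contraNN => /lee_functional_ideal; rewrite /lee_functional.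
move: (sT); rewrite inE => /andP[sD /eqP sd].
rewrite (bigD1 s) //= [X in _ + X]big1 ?addr0 => [|t /andP[tT ts]].
  rewrite line_eval_prod sd coefZ coefXn eqxx mulr1 /weight.
  have -> : \prod_(u in s) facet_coord s u = \prod_(u in s) y s u.
    by apply: eq_bigr => u us; rewrite /facet_coord us.
  rewrite divfK; first by move/eqP.
  by apply/prodf_neq0 => u us; rewrite y_neq0.
move: (tT); rewrite inE => /andP[tD /eqP td].
have /subsetPn[u us ut] : ~~ (s \subset t).
  by apply: contra ts => st; rewrite eq_sym eqEcard st sd td leqnn.
by rewrite line_eval_prod (bigD1 u) //= /facet_coord (negPf ut) mul0r scale0r coef0 mulr0.
Qed.

End LeeFunctional.

(** * The order on the vertices of a face *)

Section Positions.
Variable V : finType.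
Implicit Types (t r : {set V}) (u w : V).

Lemma position_lt_card t u : u \in t -> (position t u < #|t|)%N.
Proof.
move=> ut; apply: proper_card; apply/properP; split.
  by apply/subsetP => w; rewrite inE => /andP[].
by exists u; rewrite // inE ltnn andbF.
Qed.

Lemma position_mono t u w : u \in t -> (enum_rank u < enum_rank w)%N ->
  (position t u < position t w)%N.
Proof.
move=> ut uw; apply: proper_card; apply/properP; split.
  by apply/subsetP => x; rewrite !inE => /andP[-> /ltn_trans]; apply.
by exists u; rewrite !inE ut ?ltnn ?andbF.
Qed.

Lemma position_inj t : {in t &, injective (position t)}.
Proof.
move=> u w ut wt E; have [uw|wu|uw] := ltngtP (enum_rank u) (enum_rank w).
- by have := position_mono ut uw; rewrite E ltnn.
- by have := position_mono wt wu; rewrite E ltnn.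
- exact/enum_rank_inj/ord_inj.
Qed.

Lemma position_surj t p : (p < #|t|)%N -> exists2 u, u \in t & position t u = p.
Proof.
move=> pt; pose q := [seq position t u | u <- enum t].
have uq : uniq q.
  by rewrite map_inj_in_uniq ?enum_uniq // => u w; rewrite !mem_enum; apply: position_inj.
have subq : {subset q <= iota 0 #|t|}.
  by move=> _ /mapP[u ut ->]; rewrite mem_iota position_lt_card // -mem_enum.
have [|_ qE] := uniq_min_size uq subq; first by rewrite size_iota size_map -cardE.
have : p \in q by rewrite qE mem_iota.
by move=> /mapP[u ut pE]; exists u; rewrite // -mem_enum.
Qed.

Variable v : V.

Definition vertex_at t (p : nat) : V := odflt v [pick u in t | position t u == p].

Lemma vertex_atP t p : (p < #|t|)%N -> vertex_at t p \in t /\ position t (vertex_at t p) = p.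
Proof.
move=> /position_surj[u ut up]; rewrite /vertex_at; case: pickP => [w /andP[wt /eqP]|] //.
by move=> /(_ u); rewrite ut up eqxx.
Qed.

Lemma vertex_atK t u : u \in t -> vertex_at t (position t u) = u.
Proof.
by move=> ut; have [? ?] := vertex_atP (position_lt_card ut); apply: (@position_inj t).
Qed.

(** Deleting the column of u from the matrix of [u |: r] thus gives the matrix of r, as cofactor
    expansion requires. *)
Lemma vertex_at_bump r u p : u \notin r -> (p < #|r|)%N ->
  vertex_at (u |: r) (bump (position (u |: r) u) p) = vertex_at r p.
Proof.
move=> ur pr; have [xr xp] := vertex_atP pr; set x := vertex_at r p in xr xp *.
have xt : x \in u |: r by rewrite in_setU1 xr orbT.
rewrite -[RHS](vertex_atK xt); congr (vertex_at _ _).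
have [xu|ux|xu] := ltngtP (enum_rank x) (enum_rank u).
- have := position_mono xt xu; have := position_lt (u |: r) xu; rewrite setU1K // xp => <- H.
  by rewrite /bump leqNgt H.
- have := position_mono (setU11 u r) ux; have := position_gt (setU11 u r) ux.
  by rewrite setU1K // xp => ->; rewrite ltnS /bump => ->.
- by move: ur; rewrite -(enum_rank_inj (ord_inj xu)) xr.
Qed.

End Positions.

(** * Lee's functional for generic columns *)

Section GenericFacet.
Variables (K : fieldType) (V : finType) (D : {set {set V}}) (d : nat).
Variables (a : 'I_d -> V -> K) (v : V) (z : {set V} -> K).

Hypothesis Dcomplex : simplicial_complex D.
Hypothesis d_gt0 : (0 < d)%N.
Hypothesis face_facet : forall r : {set V}, r \in D ->
  exists2 t : {set V}, t \in D & r \subset t /\ #|t| = d.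
Hypothesis vD : v \notin vertices D.
Hypothesis generic : forall g : 'I_d -> V, injective g ->
  (forall p, g p \in v |: vertices D) -> \matrix_(i, p) a i (g p) \in unitmx.
Hypothesis z_supp : forall t, t \notin D -> z t = 0.
Hypothesis z_cycle : forall r : {set V}, #|r|.+1 = d ->
  \sum_(u | u \notin r) z (u |: r) * (-1) ^+ position (u |: r) u = 0.

Local Notation w := (fun i => a i v).

Definition facet_mx (t : {set V}) : 'M[K]_d := \matrix_(i, p) a i (vertex_at v t p).
Definition ridge_mx (r : {set V}) : 'M[K]_(d, d.-1) := \matrix_(i, p) a i (vertex_at v r p).
Definition coords t : 'cV[K]_d := invmx (facet_mx t) *m \col_i w i.
Definition coord_at t u : K := \sum_(p < d | position t u == p) coords t p 0.
(** Column p of the matrix of t is replaced by the column of [v], as in Cramer's rule. *)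
Definition swap_at t (p q : 'I_d) : V := if q == p then v else vertex_at v t q.
(** The determinant of the columns w, followed by those of r, expanded along the column w. *)
Definition ridge_det (r : {set V}) : K := \sum_(i < d) (-1) ^+ i * \det (row' i (ridge_mx r)) * w i.

Section Facet.
Variable t : {set V}.
Hypotheses (tD : t \in D) (td : #|t| = d).

Lemma vertex_at_facet (p : 'I_d) : vertex_at v t p \in t.
Proof. by have [] := @vertex_atP _ v t p; rewrite ?td. Qed.

Lemma position_vertex_at (p : 'I_d) : position t (vertex_at v t p) = p.
Proof. by have [] := @vertex_atP _ v t p; rewrite ?td. Qed.

Lemma facet_vertex u : u \in t -> exists p : 'I_d, vertex_at v t p = u.
Proof.
move=> ut; have pd : (position t u < d)%N by rewrite -td position_lt_card.
by exists (Ordinal pd); apply: vertex_atK.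
Qed.

Lemma face_vertex u : u \in t -> u \in vertices D.
Proof. by move=> ut; rewrite inE; apply: (proj2 Dcomplex) tD _; rewrite sub1set. Qed.

Lemma facet_unit : facet_mx t \in unitmx.
Proof.
apply: generic => [p q E|p]; last by rewrite in_setU1 face_vertex ?vertex_at_facet ?orbT.
by apply: val_inj; rewrite /= -(position_vertex_at p) E position_vertex_at.
Qed.

Lemma swap_unit p : \matrix_(i, q) a i (swap_at t p q) \in unitmx.
Proof.
apply: generic => [q q'|q]; last first.
  rewrite /swap_at in_setU1; case: ifP => _; first by rewrite eqxx.
  by rewrite face_vertex ?vertex_at_facet ?orbT.
have vt (q0 : 'I_d) : v <> vertex_at v t q0.
  by move=> E; have := vertex_at_facet q0; rewrite -E => /face_vertex; apply/negP.
rewrite /swap_at; case: eqP => [->|_]; case: eqP => [->|_] //.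
- by move/vt.
- by move/esym/vt.
- by move=> E; apply: val_inj; rewrite /= -(position_vertex_at q) E position_vertex_at.
Qed.

Lemma coord_at_vertex (p : 'I_d) : coord_at t (vertex_at v t p) = coords t p 0.
Proof.
by rewrite /coord_at position_vertex_at (big_pred1 p).
Qed.

Lemma coords_sum i : \sum_(p < d) a i (vertex_at v t p) * coords t p 0 = w i.
Proof.
have := congr1 (fun M : 'cV[K]_d => M i 0) (mulKVmx facet_unit (\col_i w i)).
by rewrite [LHS]mxE [RHS]mxE => <-; apply: eq_bigr => p _; rewrite [facet_mx t i p]mxE.
Qed.

Lemma coord_at_sum i : \sum_(u in t) a i u * coord_at t u = w i.
Proof.
have -> : \sum_(u in t) a i u * coord_at t u =
    \sum_(u in [set vertex_at v t p | p : 'I_d]) a i u * coord_at t u.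
  apply: eq_bigl => u; apply/idP/imsetP => [/facet_vertex[p <-]|[p _ ->]]; first by exists p.
  exact: vertex_at_facet.
rewrite big_imset /= => [|p q _ _ E]; last first.
  by apply: val_inj; rewrite /= -(position_vertex_at p) E position_vertex_at.
by rewrite -(coords_sum i); apply: eq_bigr => p _; rewrite coord_at_vertex.
Qed.

Lemma coord_at_neq0 u : u \in t -> coord_at t u != 0.
Proof.
move=> /facet_vertex[p <-]; rewrite coord_at_vertex; apply/eqP => c0.
(* If the coordinate p of w were zero, w would be a combination of the other columns; y is that
   relation, against [swap_unit]. *)
pose y : 'cV[K]_d := \col_q (if q == p then -1 else coords t q 0).
have My : \matrix_(i, q) a i (swap_at t p q) *m y = 0.
  apply/colP => i; rewrite !mxE (bigD1 p) //= !mxE /swap_at eqxx mulrN1.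
  rewrite -[X in - X](coords_sum i) (bigD1 p) //= c0 mulr0 add0r addrC; apply/eqP.
  rewrite subr_eq0; apply/eqP; apply: eq_bigr => q qp.
  by rewrite !mxE /swap_at (negPf qp).
have := mulKmx (swap_unit p) y; rewrite My mulmx0 => /(congr1 (fun M : 'cV[K]_d => M p 0)).
by rewrite !mxE eqxx => /eqP; rewrite eq_sym oppr_eq0 oner_eq0.
Qed.

End Facet.

(** Cramer's rule, with the column w moved to the front at the cost of a sign. The factor
    [ridge_det r] does not depend on u. *)
Lemma ridge_coord (r : {set V}) u : u \notin r -> #|r|.+1 = d -> u |: r \in D ->
  coord_at (u |: r) u = (-1) ^+ position (u |: r) u * ridge_det r / \det (facet_mx (u |: r)).
Proof.
move=> ur rd urD; have td : #|u |: r| = d by rewrite cardsU1 ur.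
have [p pu] := facet_vertex td (setU11 u r).
have posu : position (u |: r) u = p by rewrite -{2}pu position_vertex_at.
rewrite -{2}pu coord_at_vertex // posu /coords /invmx facet_unit // mxE /ridge_det.
rewrite mulr_sumr mulr_suml; apply: eq_bigr => i _; rewrite !mxE /cofactor.
have -> : row' i (col' p (facet_mx (u |: r))) = row' i (ridge_mx r).
  apply/matrixP => j l; rewrite !mxE /= -posu vertex_at_bump //.
  by apply: leq_trans (ltn_ord l) _; rewrite -rd.
by rewrite exprD; ring.
Qed.

(** By [ridge_coord] the facet determinants cancel, and each term is a signed coefficient of the
    cycle over [ridge_det r]; the sum is a multiple of the boundary coefficient at r. *)
Lemma ridge_coord_sum (r : {set V}) : #|r|.+1 = d ->
  \sum_(u | (u \notin r) && (u |: r \in D))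
    (z (u |: r) / \det (facet_mx (u |: r))) / coord_at (u |: r) u = 0.
Proof.
move=> rd; have := z_cycle rd.
rewrite (bigID (fun u => u |: r \in D)) /= [X in _ + X]big1 ?addr0; last first.
  by move=> u /andP[_ urD]; rewrite z_supp // mul0r.
move=> zc; rewrite -[RHS](mul0r (ridge_det r)^-1) -[in RHS]zc mulr_suml.
apply: eq_bigr => u /andP[ur urD].
have td : #|u |: r| = d by rewrite cardsU1 ur.
have det0 : \det (facet_mx (u |: r)) != 0.
  by have := facet_unit urD td; rewrite unitmxE unitfE.
have := coord_at_neq0 urD td (setU11 u r); rewrite ridge_coord // => c0.
have R0 : ridge_det r != 0 by apply: contraNneq c0 => ->; rewrite mulr0 mul0r.
rewrite !invfM invrK -exprVn invrN1.
move: (\det _) det0 (_ ^+ _) ((ridge_det r)^-1) => e e0 x y.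
transitivity (z (u |: r) * x * y * (e^-1 * e)); first by ring.
by rewrite mulVf // mulr1.
Qed.

(** Complete r to a facet and replace one vertex outside r by [v]. The columns still form a basis,
    and l is the dual vector at j, a row of the inverse matrix. *)
Lemma separate_at (r : {set V}) j : r \in D -> (#|r|.+1 < d)%N -> j \in r ->
  exists l : 'I_d -> K, [/\ \sum_i l i * a i j = 1,
    forall u, u \in r -> u != j -> \sum_i l i * a i u = 0 & \sum_i l i * w i = 0].
Proof.
move=> rD rd jr; have [t tD [/subsetP rt td]] := face_facet rD.
have /subsetPn[u ut ur] : ~~ (t \subset r).
  by apply/negP => /subset_leq_card; rewrite td leqNgt ltnW.
have [p pu] := facet_vertex td ut; have [p' pj] := facet_vertex td (rt j jr).
have M := mulVmx (swap_unit tD td p).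
exists (fun i => invmx (\matrix_(i, q) a i (swap_at t p q)) p' i).
have E q : \sum_i invmx (\matrix_(i, q) a i (swap_at t p q)) p' i * a i (swap_at t p q) =
    (p' == q)%:R.
  have := congr1 (fun M : 'M[K]_d => M p' q) M; rewrite !mxE => <-.
  by apply: eq_bigr => i _; rewrite mxE.
have swapE (q : 'I_d) : vertex_at v t q \in r -> swap_at t p q = vertex_at v t q.
  by move=> qr; rewrite /swap_at; case: eqP => // qp; rewrite -pu -qp qr in ur.
split.
- by have := E p'; rewrite eqxx swapE pj.
- move=> x xr xj; have [q qx] := facet_vertex td (rt x xr).
  have := E q; rewrite swapE qx // => ->; case: eqP => // p'q.
  by rewrite -qx -pj p'q eqxx in xj.
- have := E p; rewrite /swap_at eqxx => ->; case: eqP => // p'p.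
  by rewrite -pu -p'p pj jr in ur.
Qed.

Lemma generic_facet_notin s : s \in D -> #|s| = d -> z s != 0 ->
  \prod_(u in s) var K u \notin red_ideal D a.
Proof.
move=> sD sd zs.
apply: (@facet_notin_ideal K V D d a w (fun t => z t / \det (facet_mx t)) coord_at) => //.
- by move=> t i; rewrite inE => /andP[tD /eqP td]; apply: coord_at_sum.
- by move=> t u; rewrite inE => /andP[tD /eqP td]; apply: coord_at_neq0.
- exact: ridge_coord_sum.
- exact: separate_at.
- by rewrite inE sD sd eqxx.
- rewrite mulf_neq0 // invr_eq0; have := facet_unit sD sd.
  by rewrite unitmxE unitfE.
Qed.

End GenericFacet.

(** * Generic coefficients *)

Lemma facet_dual (K : fieldType) (V : finType) (v : V) d (a : 'I_d -> V -> K) (s : {set V}) :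
  #|s| = d -> facet_mx a v s \in unitmx ->
  exists b : V -> 'I_d -> K, forall u w, u \in s -> w \in s ->
    \sum_i b u i * a i w = (u == w)%:R.
Proof.
move=> sd sunit.
exists (fun u i => \sum_(p < d | position s u == p) invmx (facet_mx a v s) p i) => u w us ws.
have [p pu] := facet_vertex v sd us; have [q qw] := facet_vertex v sd ws.
have pos (p' : 'I_d) x : vertex_at v s p' = x -> position s x = p'.
  by move=> <-; apply: position_vertex_at.
rewrite (eq_bigr (fun i => invmx (facet_mx a v s) p i * facet_mx a v s i q)) => [|i _]; last first.
  by rewrite (big_pred1 p) => [|p']; rewrite ?mxE ?qw // (pos p u).
have := congr1 (fun M : 'M[K]_d => M p q) (mulVmx sunit); rewrite !mxE => ->.
congr (nat_of_bool _)%:R; apply/idP/idP => /eqP E; first by rewrite -pu -qw E.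
by apply/eqP/val_inj; rewrite /= -(pos p u) // -(pos q w) // E.
Qed.

(** * Homomorphisms out of a fraction field *)

Section FractionLift.
Variables (R : idomainType) (K : fieldType) (f : {rmorphism R -> K}).

Definition frac_lift (f_inj : injective f) (x : {fraction R}) : K :=
  f (frac (repr x)).1 / f (frac (repr x)).2.

Variable f_inj : injective f.
Local Notation h := (frac_lift f_inj).
Local Notation tofrac := (@FracField.tofrac R).

Lemma frac_liftP n e x : e != 0 -> tofrac e * x = tofrac n -> h x = f n / f e.
Proof.
move=> e0 ex; have r0 := denom_ratioP (repr x); have rx := fraction_repr x.
have f0 y : y != 0 -> f y != 0 by move=> y0; rewrite -(rmorph0 f) (inj_eq f_inj).
apply/eqP; rewrite /h eqr_div ?f0 // -!rmorphM (inj_eq f_inj) -tofrac_eq !tofracM -rx -ex.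
by apply/eqP; ring.
Qed.

Lemma frac_lift_tofrac y : h (tofrac y) = f y.
Proof.
rewrite (@frac_liftP y 1) ?oner_eq0 ?tofrac1 ?mul1r //.
by rewrite rmorph1 divr1.
Qed.

Lemma frac_lift_mul x e n : e != 0 -> tofrac e * x = tofrac n -> f e * h x = f n.
Proof.
move=> e0 ex; rewrite (frac_liftP e0 ex) mulrC divfK //.
by rewrite -(rmorph0 f) (inj_eq f_inj).
Qed.

Fact frac_lift_is_zmod_morphism : zmod_morphism h.
Proof.
move=> x y; have r0 := denom_ratioP (repr x); have rx := fraction_repr x.
have s0 := denom_ratioP (repr y); have sy := fraction_repr y.
move: (frac (repr x)).1 (frac (repr x)).2 r0 rx => n e e0 ex.
move: (frac (repr y)).1 (frac (repr y)).2 s0 sy => n' e' e'0 ey.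
have ee0 : e * e' != 0 by rewrite mulf_neq0.
have exy : tofrac (e * e') * (x - y) = tofrac (n * e' - e * n').
  by rewrite tofracB !tofracM -ex -ey; ring.
have f0 : f (e * e') != 0 by rewrite -(rmorph0 f) (inj_eq f_inj).
apply: (mulfI f0); rewrite (frac_lift_mul ee0 exy) mulrBr rmorphB !rmorphM.
by rewrite -(frac_lift_mul e0 ex) -(frac_lift_mul e'0 ey); ring.
Qed.
HB.instance Definition _ :=
  GRing.isZmodMorphism.Build {fraction R} K h frac_lift_is_zmod_morphism.

Fact frac_lift_is_monoid_morphism : monoid_morphism h.
Proof.
split=> [|x y]; first by rewrite -tofrac1 frac_lift_tofrac rmorph1.
have r0 := denom_ratioP (repr x); have rx := fraction_repr x.
have s0 := denom_ratioP (repr y); have sy := fraction_repr y.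
move: (frac (repr x)).1 (frac (repr x)).2 r0 rx => n e e0 ex.
move: (frac (repr y)).1 (frac (repr y)).2 s0 sy => n' e' e'0 ey.
have ee0 : e * e' != 0 by rewrite mulf_neq0.
have exy : tofrac (e * e') * (x * y) = tofrac (n * n').
  by rewrite !tofracM -ex -ey; ring.
have f0 : f (e * e') != 0 by rewrite -(rmorph0 f) (inj_eq f_inj).
apply: (mulfI f0); rewrite (frac_lift_mul ee0 exy) !rmorphM.
by rewrite -(frac_lift_mul e0 ex) -(frac_lift_mul e'0 ey); ring.
Qed.
HB.instance Definition _ :=
  GRing.isMonoidMorphism.Build {fraction R} K h frac_lift_is_monoid_morphism.

End FractionLift.

Lemma fraction_lift (R : idomainType) (K : fieldType) (f : {rmorphism R -> K}) :
  injective f -> exists h : {rmorphism {fraction R} -> K},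
    forall x, h (FracField.tofrac x) = f x.
Proof. by move=> f_inj; exists (frac_lift f_inj) => x; apply: frac_lift_tofrac. Qed.

Section GenericCoefficients.
Variables (F : fieldType) (d : nat) (V : finType) (D : {set {set V}}).

Local Notation m := #|vertices D|.
Local Notation R := {mpoly F[d * m]}.

Definition coef_var (i : 'I_d) (u : V) : R :=
  if boolP (u \in vertices D) is AltTrue uD then 'X_(mxvec_index i (enum_rank_in uD u)) else 0.

Definition generic_mx (i : 'I_d) (u : V) : generic_field F d D :=
  FracField.tofrac (coef_var i u).

Lemma coef_var_vertex i j : coef_var i (enum_val j) = 'X_(mxvec_index i j).
Proof.
rewrite /coef_var; case: {-}_ / boolP => [jD|]; last by rewrite enum_valP.
by congr 'X_(mxvec_index i _); apply: enum_valK_in.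
Qed.

Lemma coef_eval (S : comNzRingType) (f : {rmorphism F -> S}) (b : 'I_d -> V -> S) :
  exists h : {rmorphism R -> S}, (forall e, h e%:MP = f e) /\
    forall i u, u \in vertices D -> h (coef_var i u) = b i u.
Proof.
exists (mmap f (fun l => mxvec (\matrix_(i < d, j < m) b i (enum_val j)) 0 l)).
split=> [e|i u uD]; first by rewrite /= mmapC.
rewrite -(enum_rankK_in uD uD) coef_var_vertex /= mmapX mmap1U mxvecE mxE.
by [].
Qed.

Lemma coef_eval_unique (S : comNzRingType) (f g : {rmorphism R -> S}) :
  (forall e, f e%:MP = g e%:MP) ->
  (forall i u, u \in vertices D -> f (coef_var i u) = g (coef_var i u)) -> f =1 g.
Proof.
move=> fgC fgX p; elim/mpoly_ind_var: p => [//|p q IHp IHq|l p IH].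
  by rewrite (rmorphD f) (rmorphD g) IHp IHq.
rewrite (rmorphM f) (rmorphM g) IH; congr (_ * _).
case/mxvec_indexP: l => i j; rewrite -coef_var_vertex; apply: fgX.
exact: enum_valP.
Qed.

(** The determinant is a nonzero polynomial, since some specialization of the variables turns the
    matrix into the identity. *)
Lemma generic_unit (g : 'I_d -> V) : injective g -> (forall p, g p \in vertices D) ->
  \matrix_(i, p) generic_mx i (g p) \in unitmx.
Proof.
move=> g_inj gD; have -> : \matrix_(i, p) generic_mx i (g p) =
    map_mx (@FracField.tofrac R) (\matrix_(i, p) coef_var i (g p)).
  by apply/matrixP => i p; rewrite !mxE.
rewrite unitmxE unitfE det_map_mx tofrac_eq0; apply/eqP => det0.
have [h [hC hX]] := coef_eval idfun (fun i u => (u == g i)%:R).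
have := congr1 h det0; rewrite -det_map_mx rmorph0.
have -> : map_mx h (\matrix_(i, p) coef_var i (g p)) = 1%:M.
  by apply/matrixP => i p; rewrite !mxE hX // (inj_eq g_inj) eq_sym.
by rewrite det1 => /eqP; rewrite oner_eq0.
Qed.

Lemma generically_anisotropicE :
  generically_anisotropic F d D <-> anisotropic_over D generic_mx.
Proof.
rewrite -anisotropic_vertex_forms /generically_anisotropic.
suff -> : @generic_form F d V D = vertex_forms D generic_mx by [].
apply/funext => i; apply: eq_bigr => j _.
by rewrite /generic_mx coef_var_vertex.
Qed.

Lemma anisotropic_small : (d <= 1)%N -> generically_anisotropic F d D.
Proof.
move=> d1; apply/generically_anisotropicE => -[|i] id p pi p2.
  exact: anisotropic_degree0.
by have := leq_trans id d1; rewrite doubleS.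
Qed.

End GenericCoefficients.

Lemma var_neq0 (K : fieldType) (V : finType) (u : V) : var K u != 0.
Proof. by rewrite /var -msize_poly_eq0 msizeX. Qed.

(** * The two directions over the generic fields *)

Section Bistellar.
Variables (F : fieldType) (d : nat) (V : finType) (D : {set {set V}}) (s : {set V}) (v : V).

Hypothesis Dsphere : homology_sphere F (d%:Z - 1) D.
Hypothesis sfacet : facet D s.
Hypothesis vD : v \notin vertices D.
Hypothesis d_gt1 : (1 < d)%N.

Local Notation D' := (bistellar0 D s v).
Local Notation k := (generic_field F d D).
Local Notation k' := (generic_field F d D').
Local Notation R := {mpoly F[d * #|vertices D|]}.
Local Notation R' := {mpoly F[d * #|vertices D'|]}.
Local Notation A := (@generic_mx F d V D).
Local Notation A' := (@generic_mx F d V D').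

Let Dcomplex : simplicial_complex D := proj1 Dsphere.
Let s_d : #|s| = d := sphere_facet_card Dsphere sfacet.
Let sD : s \in D := maxsetp sfacet.

Lemma bistellar_vertices : vertices D' = v |: vertices D.
Proof.
apply/setP => u; rewrite in_setU1 ![u \in vertices _]inE; have [->|uv] := eqVneq u v.
  have := @in_bistellar_v _ D s v Dcomplex sfacet vD set0.
  rewrite in_set0 setU0 => -> //; rewrite proper0 -card_gt0 s_d; exact: ltnW.
rewrite in_bistellar ?in_set1 1?eq_sym //; have [us|_] := eqVneq [set u] s; last by rewrite andbT.
by move: s_d d_gt1; rewrite -us cards1 => <-.
Qed.

Lemma vertex_bistellar u : u \in vertices D -> u \in vertices D'.
Proof. by move=> uD; rewrite bistellar_vertices in_setU1 uD orbT. Qed.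

Lemma s_vertex u : u \in s -> u \in vertices D.
Proof. by move=> us; rewrite inE; apply: (proj2 Dcomplex) sD _; rewrite sub1set. Qed.

(** Sending the variables of the new vertex to 0 is a left inverse of the inclusion of polynomial
    rings, which therefore extends to fractions. *)
Lemma generic_embedding : exists f : {rmorphism k -> k'},
  (forall e, f (FracField.tofrac e%:MP) = FracField.tofrac e%:MP) /\
  forall i u, u \in vertices D -> f (A i u) = A' i u.
Proof.
have [g [gC gX]] := @coef_eval F d V D _ (@mpolyC _ F) (@coef_var F d V D').
have [h [hC hX]] := @coef_eval F d V D' _ (@mpolyC _ F) (@coef_var F d V D).
have gK : cancel g h.
  apply: (@coef_eval_unique _ _ _ _ _ (h \o g) idfun) => [e|i u uD] /=.
    by rewrite gC hC.
  by rewrite gX // hX ?vertex_bistellar.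
have [|f fE] := @fraction_lift R k' (@FracField.tofrac R' \o g).
  by move=> x y /= /eqP; rewrite tofrac_eq => /eqP /(can_inj gK).
by exists f; split=> [e|i u uD]; rewrite fE /= ?gC ?gX.
Qed.

Lemma generic_unit_v (g : 'I_d -> V) : injective g -> (forall p, g p \in v |: vertices D) ->
  \matrix_(i, p) A' i (g p) \in unitmx.
Proof. by move=> g_inj gD; apply: generic_unit => // p; rewrite bistellar_vertices. Qed.

(** The column of [v] over k' serves as the generic vector of Lee's formula; the conclusion then
    returns to k because ideal membership is preserved by extension. *)
Lemma facet_monomial_notin : \prod_(u in s) var k u \notin red_ideal D A.
Proof.
have [f [fC fX]] := generic_embedding.
have [z zcyc z_neq0] := sphere_fundamental_cycle Dsphere.
move: zcyc; rewrite memv_cap memv_ker => /andP[/mem_chains zD /eqP z0].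
have notin' : \prod_(u in s) var k' u \notin red_ideal D A'.
  pose io : {rmorphism F -> k'} := @FracField.tofrac R' \o @mpolyC _ F.
  apply: (@generic_facet_notin _ _ D d A' v (fun t => io (chain_coef z t))) => //.
  - exact: ltnW.
  - exact: (sphere_face_facet Dsphere).
  - exact: generic_unit_v.
  - move=> t tD; suff -> : chain_coef z t = 0 by rewrite rmorph0.
    by apply: contraNeq tD => /zD[].
  - move=> r rd; have := congr1 (fun c : chain F V => io (chain_coef c r)) z0.
    rewrite chain_coef_bdry chain_coef0 rmorph0 rmorph_sum => zr; rewrite -[RHS]zr.
    by apply: eq_bigr => u _; rewrite rmorphM rmorphXn rmorphN1.
  - by rewrite fmorph_eq0 z_neq0.
apply: contra notin' => sJ.
have := red_ideal_map f sJ; rewrite rmorph_prod /=.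
under eq_bigr do rewrite map_var.
exact: red_ideal_eq.
Qed.

Lemma generic_descent : anisotropic_over D' A' -> anisotropic_over D A.
Proof.
move=> an'; have [f [fC fX]] := generic_embedding.
apply: (anisotropic_descent (f := f)); apply: (@anisotropic_eq _ _ _ _ A').
  by move=> i u uD; rewrite fX.
have sunit : facet_mx A' v s \in unitmx.
  exact: (facet_unit Dcomplex generic_unit_v sD s_d).
have [b b_dual] := facet_dual s_d sunit.
pose c u := if u \in s then coord_at A' v s u else 0.
have c_out u : u \notin s -> c u = 0 by move=> /negPf us; rewrite /c us.
have a_v i : A' i v = \sum_u A' i u * c u.
  rewrite -[LHS](coord_at_sum Dcomplex generic_unit_v sD s_d i) big_mkcond /=.
  by apply: eq_bigr => u _; rewrite /c; case: ifP; rewrite ?mulr0.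
have c_neq0 u : u \in s -> c u != 0.
  by move=> us; rewrite /c us; apply: (coord_at_neq0 Dcomplex vD generic_unit_v sD s_d).
exact: (anisotropic_unstellar Dcomplex sfacet vD s_d c_out a_v b_dual c_neq0 an').
Qed.

Local Notation N := #|V|.
Local Notation S := {mpoly k[N]}.
Local Notation K := {fraction S}.
Local Notation tofrac := (@FracField.tofrac S).

(* The last column of the generic matrix of D', written in the basis formed by
   the columns of s, has algebraically independent coordinates over k. *)
Definition new_coef (i : 'I_d) (u : V) : S :=
  if u == v then \sum_(w in s) (A i w)%:MP * var k w else (A i u)%:MP.

(** Evaluating the indeterminates at the actual coordinates of the new column in the basis [s]
    recovers the inclusion of R' in k', so the substitution [new_coef] is injective. *)
Lemma generic_extension : exists f : {rmorphism k' -> K},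
  forall i u, u \in vertices D' -> f (A' i u) = tofrac (new_coef i u).
Proof.
have [f [fC fX]] := generic_embedding.
pose io : {rmorphism F -> S} := @mpolyC N k \o (@FracField.tofrac R \o @mpolyC _ F).
have [g [gC gX]] := @coef_eval F d V D' _ io new_coef.
pose h : {rmorphism S -> k'} := vmap f (fun u => coord_at A' v s u).
have hg : h \o g =1 @FracField.tofrac R'.
  apply: coef_eval_unique => [e|i u uD'] /=; first by rewrite gC vmapC /= fC.
  rewrite gX // /new_coef; have [->|uv] := eqVneq u v.
    rewrite (rmorph_sum h) -[RHS](coord_at_sum Dcomplex generic_unit_v sD s_d i).
    by apply: eq_bigr => w ws; rewrite (rmorphM h) /= vmapC vmapX fX ?s_vertex.
  by rewrite vmapC fX //; move: uD'; rewrite bistellar_vertices in_setU1 (negPf uv).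
have g_inj : injective g.
  move=> x y xy; apply/eqP; rewrite -tofrac_eq -!hg /= xy; exact: eqxx.
have [|f' f'E] := @fraction_lift R' K (tofrac \o g).
  by move=> x y /= /eqP; rewrite tofrac_eq => /eqP /g_inj.
by exists f' => i u uD'; rewrite f'E /= gX.
Qed.

Lemma generic_ascent : anisotropic_over D A -> anisotropic_over D' A'.
Proof.
move=> an; have [f fX] := generic_extension.
pose AK i u : K := tofrac (new_coef i u).
apply: (anisotropic_descent (f := f)); apply: (@anisotropic_eq _ _ _ _ AK).
  by move=> i u uD; rewrite fX.
have A_AK i u : u \in vertices D -> const_frac N (A i u) = AK i u.
  by move=> uD; rewrite /AK /new_coef ifN //; apply: contraNneq vD => <-.
have JK p : p \in red_ideal D AK -> p \in red_ideal D (fun i u => const_frac N (A i u)).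
  by apply: red_ideal_eq => i u uD; rewrite A_AK.
have KJ p : p \in red_ideal D (fun i u => const_frac N (A i u)) -> p \in red_ideal D AK.
  exact: red_ideal_eq.
have sunit : facet_mx A v s \in unitmx.
  apply: generic_unit => [p q E|p]; last first.
    exact/s_vertex/(vertex_at_facet v s_d).
  by apply: ord_inj; rewrite -(position_vertex_at v s_d p) E position_vertex_at.
have [b b_dual] := facet_dual s_d sunit.
pose c u : K := if u \in s then tofrac (var k u) else 0.
have [u0 u0s] : exists u0, u0 \in s by apply/card_gt0P; rewrite s_d ltnW.
pose C : 'X_{1..N} := (\sum_(u in s) U_(enum_rank u))%MM.
have XC : tofrac 'X_[C] = \prod_(u in s) c u.
  rewrite /C -mprodXE rmorph_prod; apply: eq_bigr => u us.
  by rewrite /c us.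
have c_out u : u \notin s -> c u = 0 by move=> /negPf us; rewrite /c us.
have a_v i : AK i v = \sum_u AK i u * c u.
  rewrite {1}/AK /new_coef eqxx (rmorph_sum tofrac) big_mkcond /=.
  apply: eq_bigr => u _; rewrite /c; case: ifP => us; last by rewrite mulr0.
  by rewrite -A_AK ?s_vertex // tofracM.
have bK_dual u w : u \in s -> w \in s ->
    \sum_i const_frac N (b u i) * AK i w = (u == w)%:R.
  move=> us ws; rewrite (eq_bigr (fun i => const_frac N (b u i * A i w))).
    by rewrite -rmorph_sum b_dual // rmorph_nat.
  by move=> i _; rewrite -A_AK ?s_vertex // rmorphM.
have c_neq0 u : u \in s -> c u != 0.
  by move=> us; rewrite /c us tofrac_eq0 var_neq0.
apply: (anisotropic_stellar Dcomplex sfacet vD s_d c_out a_v bK_dual c_neq0).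
  move=> i q _ id qi q2.
  by apply/KJ/(anisotropic_extension _ qi (JK _ q2)); apply: an; apply: ltnW.
move=> i q r i0 id qi /JK qr.
(* Multiplying by the monomial C clears the denominator of [socle_coef] and leaves only this sign, a
   scalar of k. *)
pose e : k := - (-1) ^+ #|s|.
have e0 : e != 0 by rewrite oppr_eq0 signr_eq0.
have Codd : odd (C (enum_rank u0)).
  rewrite mnm_sumE (bigD1 u0) //= mnm1E eqxx big1 // => u /andP[_ uu0].
  by rewrite mnm1E (inj_eq enum_rank_inj) (negPf uu0).
have an_i p : p \is i.-homog -> p ^+ 2 \in red_ideal D A -> p \in red_ideal D A.
  by apply: an; rewrite id.
have mono_map : map_mpoly (@const_frac N k) (\prod_(u in s) var k u) = \prod_(u in s) var K u.
  by rewrite rmorph_prod; apply: eq_bigr => u _; rewrite /= map_var.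
have socleE : tofrac 'X_[C] * socle_coef s c = const_frac N e.
  rewrite XC /socle_coef /e.
  have prodN : \prod_(u in s) - c u = (-1) ^+ #|s| * \prod_(u in s) c u.
    rewrite -prodr_const -big_split; apply: eq_bigr => u _ /=; exact/esym/mulN1r.
  have c0 : \prod_(u in s) c u != 0 by apply/prodf_neq0.
  by rewrite prodN invfM mulrN mulrCA mulfV // mulr1 rmorphN rmorphXn rmorphN1 -exprVn invrN1.
have qrJ : (tofrac 'X_[C])%:MP * q ^+ 2 + (const_frac N e * r ^+ 2) *:
    map_mpoly (@const_frac N k) (\prod_(u in s) var k u) \in
    red_ideal D (fun i u => const_frac N (A i u)).
  apply: in_ideal_eq (in_idealMr (tofrac 'X_[C])%:MP qr) _.
  rewrite mono_map -socleE mulrDr; congr (_ + _).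
  by rewrite mul_mpolyC scalerA mulrA mulrAC.
by have [/KJ] := anisotropic_extension_odd an_i Codd facet_monomial_notin e0 qi qrJ.
Qed.

End Bistellar.

Theorem theorem3p2 (F : fieldType) (d : nat) (V : finType)
    (Delta Delta' : {set {set V}}) :
  homology_sphere F (d%:Z - 1) Delta ->
  bistellar0_move Delta Delta' ->
  (generically_anisotropic F d Delta <-> generically_anisotropic F d Delta').
Proof.
move=> Dsphere [s [v [sfacet vD ->]]].
(* Here only degree 0 is concerned. For d = 1 the facet is itself a vertex and disappears, so the
   vertices of Delta would not persist in Delta'. *)
have [d1|d1] := leqP d 1; first by split=> _; apply: anisotropic_small.
rewrite !generically_anisotropicE; split; first exact: generic_ascent.
exact: generic_descent.
Qed.
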